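(* Let $\mathscr{D}$ be a dyadic grid in $\mathbb{R}^n$, let $\mathscr{S}\subset\mathscr{D}$ be a sparse family, let $1<p<\infty$ with $p'=p/(p-1)$, and let $w\in A_p$. Then the sparse operator $$T^{\mathscr{S}}f=\sum_{Q\in\mathscr{S}}\Big(\frac{1}{|Q|}\int_Q f\,dx\Big)\chi_Q$$ satisfies $$\|T^{\mathscr{S}}\|_{\mathscr{B}(L^p(w))}\le c_p\,[w]_{A_p}^{\max(1,\frac{p'}{p})},\qquad\text{where}\quad c_p=p\,p'\,2^{\max(\frac{p}{p'},\frac{p'}{p})}.$$
   Context: Cubes have sides parallel to the coordinate axes, and $|E|$ denotes Lebesgue measure. A dyadic grid $\mathscr{D}$ is a collection of cubes in $\mathbb{R}^n$ such that: (i) each $Q\in\mathscr{D}$ satisfies $|Q|=2^{nk}$ for some $k\in\mathbb{Z}$; (ii) if $Q,P\in\mathscr{D}$ then $Q\cap P\in\{\varnothing,P,Q\}$; (iii) for each $k\in\mathbb{Z}$, the family $\{Q\in\mathscr{D}:|Q|=2^{nk}\}$ is a partition of $\mathbb{R}^n$. A family $\mathscr{S}\subset\mathscr{D}$ is sparse if for each $Q\in\mathscr{S}$, $$\Big|\bigcup_{Q'\in\mathscr{S},\,Q'\subsetneq Q}Q'\Big|\le\tfrac12|Q|.$$ A weight $w$ is a measurable function on $\mathbb{R}^n$ with $0<w<\infty$ a.e. For $1<p<\infty$, $w\in A_p$ means $$[w]_{A_p}:=\sup_Q\Big(\frac1{|Q|}\int_Q w\,dx\Big)\Big(\frac1{|Q|}\int_Q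 w^{1-p'}\,dx\Big)^{p-1}<\infty,$$ the supremum being over all cubes $Q\subset\mathbb{R}^n$. $L^p(w)$ is the space $L^p(\mathbb{R}^n,w\,dx)$, with $\|f\|_{L^p(w)}^p=\int_{\mathbb{R}^n}|f|^pw\,dx$, and $\|\cdot\|_{\mathscr{B}(L^p(w))}$ denotes the operator norm on $L^p(w)$. $\chi_Q$ is the characteristic function of $Q$. *)

(* Defs.v *)
From HB Require Import structures.
From mathcomp Require Import all_boot all_order all_algebra.
From mathcomp Require Import all_classical all_reals all_analysis.
From mathcomp Require Import measurable_realfun.

Set Implicit Arguments.
Unset Strict Implicit.
Unset Printing Implicit Defensive.

Import Order.TTheory GRing.Theory Num.Theory.
Import numFieldNormedType.Exports.

Local Open Scope classical_set_scope.
Local Open Scope ring_scope.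

Section borel_lebesgue_Rn.
Variable R : realType.
Local Notation borelR := (measurableTypeR R).

Definition tcons n (x : borelR * n.-tuple borelR) : n.+1.-tuple borelR :=
  [tuple of x.1 :: x.2].

Lemma measurable_tcons n :
  measurable_fun [set: borelR * n.-tuple borelR] (@tcons n).
Proof.
by apply: measurable_cons; [exact: measurable_fst|exact: measurable_snd].
Qed.

HB.instance Definition _ n :=
  isMeasurableFun.Build _ _ _ _ (@tcons n) (@measurable_tcons n).

Lemma measurable_thead n :
  measurable_fun [set: n.+1.-tuple borelR] (@thead n borelR).
Proof. exact: measurable_tnth. Qed.

Section step.
Variables (n : nat) (m : {sigma_finite_measure set (n.-tuple borelR) -> \bar R}).

(* [n.+1.-tuple R] is identified with [R * n.-tuple R] through [tcons]. *)
Definition lebesgue_tcons : set (n.+1.-tuple borelR) -> \bar R :=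
  pushforward (@lebesgue_measure R \x m)%E (@tcons n).

Let lebesgue_tcons0 : lebesgue_tcons set0 = 0%E.
Proof. exact: measure0. Qed.

Let lebesgue_tcons_ge0 A : (0 <= lebesgue_tcons A)%E.
Proof. exact: measure_ge0. Qed.

Let lebesgue_tcons_sigma_additive : semi_sigma_additive lebesgue_tcons.
Proof.
exact: (@measure_semi_sigma_additive _ _ _
  (pushforward (@lebesgue_measure R \x m)%E (@tcons n))).
Qed.

HB.instance Definition _ := isMeasure.Build _ _ _ lebesgue_tcons
  lebesgue_tcons0 lebesgue_tcons_ge0 lebesgue_tcons_sigma_additive.

Lemma lebesgue_tcons_sigma_finite : sigma_finite setT lebesgue_tcons.
Proof.
have /sigma_finiteP[F [TF ndF Foo]] :=
  sigma_finiteT (@lebesgue_measure R : {sigma_finite_measure set _ -> \bar R}).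
have /sigma_finiteP[G [TG ndG Goo]] := sigma_finiteT m.
pose u (t : n.+1.-tuple borelR) : borelR * n.-tuple borelR :=
  (thead t, [tuple of behead t]).
have tconsK : cancel (@tcons n) u.
  by move=> [a t]; rewrite /u /tcons theadE; congr pair; exact/val_inj.
have mu_ : measurable_fun setT u.
  by apply/measurable_fun_pairP; split;
    [exact: measurable_thead|exact: measurable_behead].
exists (fun k => u @^-1` (F k `*` G k)).
  apply/seteqP; split => // t _.
  have [i _ Fi] : (\bigcup_i F i) (u t).1 by rewrite -TF.
  have [j _ Gj] : (\bigcup_i G i) (u t).2 by rewrite -TG.
  exists (maxn i j) => //; split.
    exact: (subsetPset _ _ (ndF _ _ (leq_maxl i j))) Fi.
  exact: (subsetPset _ _ (ndG _ _ (leq_maxr i j))) Gj.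
move=> k; have [mFk Fk] := Foo k; have [mGk Gk] := Goo k; split.
  by rewrite -[X in measurable X]setTI; apply: mu_ => //; exact: measurableX.
rewrite /lebesgue_tcons /pushforward -comp_preimage (_ : _ \o _ = id).
  by rewrite preimage_id product_measure1E// lte_mul_pinfty// ge0_fin_numE.
exact/funext.
Qed.

HB.instance Definition _ :=
  Measure_isSigmaFinite.Build _ _ _ lebesgue_tcons lebesgue_tcons_sigma_finite.

End step.

Lemma dirac_nil_sigma_finite :
  sigma_finite setT (dirac ([tuple] : 0.-tuple borelR) : set _ -> \bar R).
Proof.
exists (fun=> setT); first by rewrite bigcup_const//; exists 0%N.
by move=> _; split => //; rewrite diracT ltry.
Qed.

Definition lebesgue_nil : set (0.-tuple borelR) -> \bar R := dirac [tuple].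
HB.instance Definition _ := Measure.on lebesgue_nil.
HB.instance Definition _ :=
  Measure_isSigmaFinite.Build _ _ _ lebesgue_nil dirac_nil_sigma_finite.

(* n-fold product of the one-dimensional Lebesgue measure, on Borel sets *)
Fixpoint borel_lebesgue n :
    {sigma_finite_measure set (n.-tuple borelR) -> \bar R} :=
  if n is k.+1 then lebesgue_tcons (borel_lebesgue k) else lebesgue_nil.

End borel_lebesgue_Rn.

(* R^n with the sigma-algebra of all Lebesgue (not only Borel) measurable sets *)
Notation Rn R n := (caratheodory_type (borel_lebesgue R n)^*%mu).

Definition lebesgue_Rn (R : realType) (n : nat) : set (Rn R n) -> \bar R :=
  @completed_measure_extension _ _ _ (borel_lebesgue R n).
HB.instance Definition _ R n := Measure.on (@lebesgue_Rn R n).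

Section sparse_domination.
Variables (R : realType) (n : nat).
Local Notation T := (Rn R n).
Local Notation mu := (@lebesgue_Rn R n).
Local Open Scope ereal_scope.

(* Each of the 2n faces may or may not belong to the cube. *)
Definition cube (Q : set T) : Prop :=
  exists (l : R) (a : 'I_n -> R) (bl br : 'I_n -> bool),
    (0 < l)%R /\
    Q = [set x : T | forall i : 'I_n,
          tnth (x : n.-tuple R) i \in
            Interval (BSide (bl i) (a i)) (BSide (br i) (a i + l)%R)].

Definition dyadic_grid (D : set (set T)) : Prop :=
  [/\ D `<=` cube,
      forall Q, D Q -> exists k : int, mu Q = ((2 : R) ^ (n%:Z * k))%:E,
      forall Q P, D Q -> D P ->
        [\/ Q `&` P = set0, Q `&` P = P | Q `&` P = Q]
    & forall k : int,
        partition [set Q | D Q /\ mu Q = ((2 : R) ^ (n%:Z * k))%:E] id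
          [set: T]].

Definition sparse (S : set (set T)) : Prop :=
  forall Q, S Q ->
    mu (\bigcup_(Q' in [set Q' | S Q' /\ Q' `<` Q]) Q') <= (2^-1)%:E * mu Q.

Definition average (f : T -> \bar R) (Q : set T) : \bar R :=
  (mu Q)^-1 * \int[mu]_(x in Q) f x.

(* Values of [w] on a null set are irrelevant, hence the extended codomain. *)
Definition weight (w : T -> \bar R) : Prop :=
  measurable_fun setT w /\ {ae mu, forall x, 0 < w x < +oo}.

Definition conj_exp (p : R) : R := (p / (p - 1))%R.

Definition Ap_const (p : R) (w : T -> \bar R) : \bar R :=
  ereal_sup [set average w Q *
                 average (fun x => w x `^ (1 - conj_exp p)) Q `^ (p - 1)
            | Q in cube].

Definition Ap (p : R) (w : T -> \bar R) : Prop :=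
  weight w /\ Ap_const p w < +oo.

Definition Lpw_norm (p : R) (w : T -> \bar R) (f : T -> R) : \bar R :=
  (\int[mu]_x ((`|f x| `^ p)%:E * w x)) `^ p^-1.

Definition Lpw (p : R) (w : T -> \bar R) : set (T -> R) :=
  [set f | measurable_fun setT f /\ Lpw_norm p w f < +oo].

Definition Lpw_opnorm (p : R) (w : T -> \bar R) (A : (T -> R) -> (T -> R)) :
    \bar R :=
  ereal_sup [set Lpw_norm p w (A f) | f in Lpw p w `&`
                                          [set f | Lpw_norm p w f <= 1]].

Definition sparse_term (f : T -> R) (x : T) (Q : set T) : \bar R :=
  average (EFin \o f) Q * (\1_Q x)%:E.

(* [\esum] is only meaningful for nonnegative terms, hence the splitting: this
   is the sum of the series wherever it converges absolutely. *)
Definition sparse_op (S : set (set T)) (f : T -> R) (x : T) : R :=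
  fine (\esum_(Q in S) (sparse_term f x)^\+ Q
        - \esum_(Q in S) (sparse_term f x)^\- Q).

(* What speaking of the operator norm of T^S on L^p(w) presupposes; it also rules
   out the default values that integrals, [\esum] and [fine] take when the
   averages or the series are undefined. *)
Definition sparse_op_well_defined (S : set (set T)) (p : R)
    (w : T -> \bar R) : Prop :=
  forall f, Lpw p w f ->
    [/\ forall Q, S Q -> mu.-integrable Q (EFin \o f),
        {ae mu, forall x, summable S (sparse_term f x)}
      & Lpw p w (sparse_op S f)].

End sparse_domination.

(* Main.v *)
(* Moen's argument. On a finite subfamily F of S the cores E_Q = Q minus the
   smaller members of F are disjoint, |Q| <= 2 |E_Q|, and every integral over a
   member of F is the sum of the integrals over the cores below it, so that the
   estimate becomes an inequality between finite sums over a forest. Put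
   sigma = w^(1-p'). For p >= 2 the form
     sum_Q |Q|^-1 (int_Q |f|) (int_Q g w)
   is at most [w]_{A_p} times
     sum_Q |Q|^(p-1) sigma(Q)^(2-p) <f/sigma>_{Q,sigma} <g>_{Q,w},
   where, sigma(Q)^(2-p) being at most sigma(E_Q)^(2-p),
   |Q|^(p-1) sigma(Q)^(2-p) <= 2^(p-1) sigma(E_Q)^(1/p) w(E_Q)^(1/p').
   Hoelder's inequality and the bounds p' and p for the maximal functions of the
   forest with respect to sigma and w conclude; p < 2 is the dual case. The
   maximal bound is Doob's inequality, in the pathwise form
   sum (M^p s - p' M^(p-1) a) <= 0. Monotone convergence then passes from finite
   subfamilies to the countable family S. *)
Require Import Defs.
From mathcomp Require Import all_boot all_order all_algebra finmap.
From mathcomp Require Import all_classical all_reals all_analysis.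
From mathcomp Require Import measurable_realfun ring lra.

Import Order.TTheory GRing.Theory Num.Theory.
Import numFieldNormedType.Exports.

Local Open Scope ring_scope.

Set Implicit Arguments.
Unset Strict Implicit.
Unset Printing Implicit Defensive.

(** * Weighted inequalities on finite forests *)

Section conjugate_exponents.
Variables (R : realType) (p q : R).
Hypotheses (p0 : 0 < p) (q0 : 0 < q) (pq : p^-1 + q^-1 = 1).

Lemma conjugateD : p + q = p * q.
Proof.
have := congr1 (fun x => p * q * x) pq.
by rewrite mulr1 mulrDr mulrAC mulfV ?gt_eqF// mul1r mulfK ?gt_eqF// addrC.
Qed.

Lemma conjugate_gt1 : 1 < p.
Proof.
by rewrite -invf_lt1// -pq ltrDl invr_gt0.
Qed.

Lemma conjugate_div : p / q = p - 1.
Proof.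
apply: (mulIf (lt0r_neq0 q0)); rewrite divfK ?gt_eqF//.
by rewrite mulrBl -conjugateD mul1r addrK.
Qed.

Lemma conjugate_subM : (p - 1) * q = p.
Proof. by rewrite -conjugate_div divfK// gt_eqF. Qed.

Lemma powRVK (x : R) : 0 <= x -> (x `^ p^-1) `^ p = x.
Proof. by move=> x0; rewrite -powRrM mulVf ?gt_eqF// powRr1. Qed.

(** Division by [X ^ (1/q)], possible since [X] is a real number. Both the maximal inequality and
    the duality argument end with the unknown on both sides and are closed this way. *)
Lemma le_powRV_absorb (X c : R) : 0 <= X -> 0 <= c ->
  X <= c * X `^ q^-1 -> X `^ p^-1 <= c.
Proof.
rewrite le_eqVlt => /predU1P[<- c0 _|X0 c0].
  by rewrite powR0// gt_eqF// invr_gt0.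
have -> : p^-1 = 1 - q^-1 by rewrite -pq addrK.
rewrite powRB; last by apply/implyP => _; rewrite lt0r_neq0.
by rewrite (powRr1 (ltW X0)) ler_pdivrMr// powR_gt0.
Qed.

Lemma hoelder_sum (I : Type) (r : seq I) (P : pred I) (x y : I -> R) :
  (forall i, 0 <= x i) -> (forall i, 0 <= y i) ->
  \sum_(i <- r | P i) x i * y i <=
  (\sum_(i <- r | P i) x i `^ p) `^ p^-1 *
  (\sum_(i <- r | P i) y i `^ q) `^ q^-1.
Proof.
move=> x0 y0; elim: r => [|i r IH].
  by rewrite !big_nil mulr_ge0// powR_ge0.
rewrite !big_cons; case: ifP => // Pi.
apply: (le_trans (lerD (lexx _) IH)).
have aux X Y : 0 <= X -> 0 <= Y -> x i * y i + X `^ p^-1 * Y `^ q^-1 <=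
    (x i `^ p + X) `^ p^-1 * (y i `^ q + Y) `^ q^-1.
  move=> X0 Y0.
  have := hoelder2 (x0 i) (powR_ge0 X p^-1) (y0 i) (powR_ge0 Y q^-1) p0 q0 pq.
  by rewrite (powRVK X0) -(powRrM Y) mulVf ?lt0r_neq0// (powRr1 Y0).
by apply: aux; apply: sumr_ge0 => j _; exact: powR_ge0.
Qed.

End conjugate_exponents.

(** * Maximal functions and the sparse form on a forest *)

Section forest.
Variables (R : realType) (I : finType) (le : rel I).
Hypotheses (le_refl : reflexive le) (le_trans' : transitive le)
  (le_forest : forall i j k, le i j -> le i k -> le j k || le k j).

(** If [f] lists integrals over the cores, this is the integral over the whole [i]-th set. *)
Definition below (f : I -> R) (i : I) : R := \sum_(j | le j i) f j.

Lemma le_below f i : (forall j, 0 <= f j) -> f i <= below f i.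
Proof.
by move=> f0; rewrite /below (bigD1 i)//= lerDl sumr_ge0.
Qed.

Section maximal.
Variables (p q : R).
Hypotheses (p0 : 0 < p) (q0 : 0 < q) (pq : p^-1 + q^-1 = 1).
Variables (s a b : I -> R).
Hypotheses (s0 : forall i, 0 < s i) (a0 : forall i, 0 <= a i)
  (b0 : forall i, 0 <= b i)
  (ab : forall i, a i <= b i `^ p^-1 * s i `^ q^-1).

(** If [a] and [s] list the integrals of [h sigma] and [sigma] over the cores, this is the average
    of [h] over the [i]-th set with respect to [sigma]. *)
Let A i := below a i / below s i.

Let S_gt0 i : 0 < below s i.
Proof. by rewrite (lt_le_trans (s0 i))// le_below// => j; exact/ltW. Qed.

Let A_ge0 i : 0 <= A i.
Proof. by rewrite divr_ge0 ?(ltW (S_gt0 _))// /below sumr_ge0. Qed.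

(** The maximal function of these averages along the nodes of [G], as a function on cores; it is 0
    where no node of [G] lies above. *)
Let M (G : {set I}) i : R := \big[Num.max/0]_(k | (k \in G) && le i k) A k.

Let M_ge0 G i : 0 <= M G i.
Proof. exact: bigmax_ge_id. Qed.

(** Since [q (p - 1) = p], the function [t^p - q t^(p-1) x] of [t >= 0] is least at [t = x], which
    is Young's inequality for [x] and [m^(p-1)]. *)
Let young_step (m x : R) : 0 <= m -> 0 <= x ->
  Num.max x m `^ p - q * Num.max x m `^ (p - 1) * x <=
  m `^ p - q * m `^ (p - 1) * x.
Proof.
move=> m0 x0; case: (leP x m) => // /ltW mx.
have := conjugate_powR x0 (powR_ge0 m (p - 1)) p0 q0 pq.
rewrite -powRrM (conjugate_subM p0 q0 pq) => h.
have -> : q * x `^ (p - 1) * x = q * x `^ p.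
  by rewrite -mulrA [_ * x]mulrC mulr_powRB1.
have : q * (x * m `^ (p - 1)) <= q * (x `^ p / p + m `^ p / q) by rewrite ler_pM2l.
rewrite mulrDr [q * (_ / q)]mulrC divfK ?gt_eqF//.
have -> : q * (x `^ p / p) = (q - 1) * x `^ p.
  have pq' : q^-1 + p^-1 = 1 by rewrite addrC.
  by rewrite -(conjugate_div q0 p0 pq'); ring.
by lra.
Qed.

(* Inserting a minimal node [k] into [G] changes the maximal function only below
   [k], from a constant [m] to [max (A k) m]; by Young's inequality the sum does
   not increase. *)
Let doob_functional G :
  \sum_i (M G i `^ p * s i - q * M G i `^ (p - 1) * a i) <= 0.
Proof.
have [n] := ubnP #|G|; elim: n G => // n IH G Gn.
have p1 := conjugate_gt1 p0 q0 pq.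
have [->|/set0Pn[k0 k0G]] := eqVneq G finset.set0.
  rewrite big1// => i _; rewrite /M big_pred0 => [|j]; last by rewrite inE.
  by rewrite !powR0 ?gt_eqF ?subr_gt0// mulr0 !mul0r subrr.
(* Having the fewest descendants, [k] has no node of [G] strictly below it. *)
pose k := [arg min_(k < k0 in G) #|[pred j | le j k]|].
have [kG kmin] : k \in G /\ forall k', k' \in G ->
    (#|[pred j | le j k]| <= #|[pred j | le j k']|)%N.
  by rewrite /k; case: arg_minnP.
pose G' := G :\ k.
have {}IH := IH G'.
have /IH {}IH : (#|G'| < n)%N by rewrite /G' (cardsD1 k) kG in Gn *.
apply: (le_trans _ IH).
(* A node of [G] above some [i] under [k] is comparable with [k] by the forest property, and
   minimality of [k] puts it above [k]. Hence [M G] is constant below [k]. *)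
have leG i j : j \in G -> le i k -> le i j = le k j.
  move=> jG ik; apply/idP/idP => [ij|]; last exact: le_trans' ik.
  have /orP[//|jk] := le_forest ik ij.
  have sub : [pred l | le l j] \subset [pred l | le l k].
    by apply/fintype.subsetP => l; rewrite !inE => lj; exact: le_trans' jk.
  have [_] := subset_leqif_card sub; rewrite eqn_leq subset_leq_card// kmin//.
  by move=> /esym/fintype.subsetP/(_ k); rewrite !inE le_refl; apply.
have MG i : M G i = if le i k then Num.max (A k) (M G' k) else M G' i.
  case: ifPn => ik.
    rewrite {1}/M (bigmaxD1 k)/= ?kG//; congr Num.max.
    apply: eq_bigl => j; rewrite !inE.
    by case: (boolP (j \in G)) => [jG|]; rewrite ?andbF// (leG _ _ jG ik) andbT andbC.
  apply: eq_bigl => j; rewrite !inE.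
  by case: (j =P k) => [->|//]; rewrite (negbTE ik) andbF.
have MG' i : le i k -> M G' i = M G' k.
  move=> ik; apply: eq_bigl => j; rewrite !inE.
  by case: (boolP (j \in G)) => [jG|]; rewrite ?andbF//= leG.
rewrite [leLHS](bigID (le^~ k))/= [leRHS](bigID (le^~ k))/= lerD//; last first.
  by apply: ler_sum => i /negbTE ik; rewrite MG ik.
(* With a constant [m] the sum below [k] sees only the totals of [s] and [a], and
   [below a k = A k * below s k]. *)
have fold m : \sum_(i | le i k) (m `^ p * s i - q * m `^ (p - 1) * a i) =
    (m `^ p - q * m `^ (p - 1) * A k) * below s k.
  rewrite big_split/= -mulr_sumr sumrN -mulr_sumr -/(below s k) -/(below a k).
  by rewrite mulrBl -(mulrA _ (A k)) /A divfK// gt_eqF.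
rewrite (eq_bigr (fun i => Num.max (A k) (M G' k) `^ p * s i -
    q * Num.max (A k) (M G' k) `^ (p - 1) * a i)) => [|i ik]; last by rewrite MG ik.
rewrite [leRHS](eq_bigr (fun i => M G' k `^ p * s i -
    q * M G' k `^ (p - 1) * a i)) => [|i ik]; last by rewrite MG'.
by rewrite !fold ler_pM2r// young_step.
Qed.

(** With all nodes in [G], [doob_functional] bounds [X], the sum of [N^p s], by [q] times the sum of
    [N^(p-1) a]. By [ab], Hoelder and [(p - 1) q = p] this is at most [q (sum b)^(1/p) X^(1/q)], and
    [X^(1/q)] is absorbed. *)
Lemma forest_maximal_bound :
  (\sum_i (below a i / below s i) `^ p * s i) `^ p^-1 <=
  q * (\sum_i b i) `^ p^-1.
Proof.
pose N i := M finset.setT i.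
have AN i : A i <= N i.
  by rewrite /N /M (le_bigmax_cond _ (fun k => A k))// inE le_refl.
have N0 i : 0 <= N i by exact: M_ge0.
pose X := \sum_i N i `^ p * s i.
have X0 : 0 <= X by apply: sumr_ge0 => i _; rewrite mulr_ge0 ?powR_ge0// ltW.
apply: (@le_trans _ _ (X `^ p^-1)).
  rewrite ge0_ler_powR ?invr_ge0 ?nnegrE ?(ltW p0)//.
    by apply: sumr_ge0 => i _; rewrite mulr_ge0 ?powR_ge0// ltW.
  apply: ler_sum => i _; rewrite ler_pM2r// ge0_ler_powR ?nnegrE ?(ltW p0)//.
  - exact: A_ge0.
  - exact: AN.
apply: (le_powRV_absorb p0 pq) => //.
  by rewrite mulr_ge0 ?powR_ge0// ltW.
have : X <= q * \sum_i N i `^ (p - 1) * a i.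
  have := doob_functional finset.setT; rewrite big_split/= sumrN subr_le0.
  by rewrite mulr_sumr; under [leRHS]eq_bigr do rewrite -mulrA.
move=> /le_trans; apply; rewrite -mulrA ler_pM2l//.
apply: (@le_trans _ _ (\sum_i (b i `^ p^-1) * (N i `^ (p - 1) * s i `^ q^-1))).
  by apply: ler_sum => i _; rewrite mulrCA ler_wpM2l ?powR_ge0.
apply: le_trans (hoelder_sum p0 q0 pq _ _ _ _) _.
- by move=> i; exact: powR_ge0.
- by move=> i; rewrite mulr_ge0// powR_ge0.
under eq_bigr do rewrite powRVK//.
rewrite ler_wpM2l ?powR_ge0// /X.
under eq_bigr do
  rewrite powRM ?powR_ge0// -powRrM conjugate_subM// powRVK ?(ltW (s0 _))//.
by [].
Qed.

End maximal.

Section bilinear.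
(** In the application [e] and [mu] measure the core and the whole of a member, while [t] and [s]
    are the masses of [w] and of its dual weight on the core. *)
Variables (e mu t s : I -> R).
Hypotheses (e0 : forall i, 0 < e i) (mu0 : forall i, 0 < mu i)
  (mu_e : forall i, mu i <= 2 * e i)
  (t0 : forall i, 0 < t i) (s0 : forall i, 0 < s i).

(* [below s i * below t i / mu i] is at most
   [L `^ p * mu i `^ (p - 1) * below s i `^ (2 - p)]; as [2 - p <= 0], [below s i]
   may be replaced by [s i]. *)
Lemma sparse_form_bound_ge2 (p q L : R) (a b c d : I -> R) :
  0 < p -> 0 < q -> p^-1 + q^-1 = 1 -> 2 <= p ->
  (forall i, e i <= t i `^ p^-1 * s i `^ q^-1) ->
  (forall i, below t i `^ p^-1 * below s i `^ q^-1 <= L * mu i) ->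
  (forall i, 0 <= a i) -> (forall i, 0 <= b i) ->
  (forall i, 0 <= c i) -> (forall i, 0 <= d i) ->
  (forall i, a i <= b i `^ p^-1 * s i `^ q^-1) ->
  (forall i, c i <= d i `^ q^-1 * t i `^ p^-1) ->
  \sum_i below a i * below c i / mu i <=
  p * q * 2 `^ (p - 1) * L `^ p *
    (\sum_i b i) `^ p^-1 * (\sum_i d i) `^ q^-1.
Proof.
move=> p0 q0 pq p2 ets TSL a0 b0 c0 d0 ab cd.
have qp : q^-1 + p^-1 = 1 by rewrite addrC.
have S_gt0 i : 0 < below s i.
  by rewrite (lt_le_trans (s0 i))// le_below// => j; exact/ltW.
have T_gt0 i : 0 < below t i.
  by rewrite (lt_le_trans (t0 i))// le_below// => j; exact/ltW.
(* The sign of [L] is read off an index; over an empty forest nothing constrains it. *)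
have L0 (i : I) : 0 < L.
  have : 0 < L * mu i by rewrite (lt_le_trans _ (TSL i))// mulr_gt0// powR_gt0.
  by rewrite pmulr_lgt0.
have key i : below s i * below t i / mu i <=
    2 `^ (p - 1) * L `^ p * (s i `^ p^-1 * t i `^ q^-1).
  rewrite ler_pdivrMr//.
  (* The exponent of [below s i] is split as [1 = (p - 1) + (2 - p)]; as [p/q = p - 1], the first
     part completes the A_p product. *)
  have -> : below s i * below t i =
      (below t i `^ p^-1 * below s i `^ q^-1) `^ p * below s i `^ (2 - p).
    rewrite powRM ?powR_ge0// ?(powRVK p0 (ltW (T_gt0 i))) -powRrM -mulrA -powRD; last first.
      by apply/implyP => _; rewrite lt0r_neq0.
    rewrite [q^-1 * p]mulrC conjugate_div//.
    by rewrite (_ : p - 1 + (2 - p) = 1); [rewrite powRr1 ?(ltW (S_gt0 i))// mulrC | ring].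
  have h1 : (below t i `^ p^-1 * below s i `^ q^-1) `^ p <= L `^ p * mu i `^ p.
    rewrite -powRM ?(ltW (L0 i)) ?(ltW (mu0 i))// ge0_ler_powR ?nnegrE ?(ltW p0)//.
    - by rewrite mulr_ge0// powR_ge0.
    - by rewrite mulr_ge0// ltW// (L0 i).
  have h2 : below s i `^ (2 - p) <= s i `^ (2 - p).
    rewrite -[2 - p]opprB !powRN lef_pV2 ?posrE ?powR_gt0//.
    rewrite ge0_ler_powR ?nnegrE ?subr_ge0// ?(ltW (s0 i)) ?(ltW (S_gt0 i))//.
    by rewrite le_below// => j; exact/ltW.
  apply: (le_trans (ler_pM (powR_ge0 _ _) (powR_ge0 _ _) h1 h2)).
  have -> : mu i `^ p = mu i `^ (p - 1) * mu i by rewrite mulrC mulr_powRB1 ?(ltW (mu0 i)).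
  (* Sparseness enters here through [mu i <= 2 * e i], and Hoelder on the core bounds [e i]. The
     exponents are [(p-1)/p = 1/q] and [(p-1)/q = p - 2 + 1/p]. *)
  have h3 : mu i `^ (p - 1) <=
      2 `^ (p - 1) * (t i `^ q^-1 * s i `^ (p - 2 + p^-1)).
    apply: (@le_trans _ _ ((2 * e i) `^ (p - 1))).
      rewrite ge0_ler_powR ?nnegrE ?mulr_ge0 ?(ltW (mu0 _)) ?(ltW (e0 _))//.
      by rewrite subr_ge0 (ltW (conjugate_gt1 p0 q0 pq)).
    rewrite powRM ?(ltW (e0 _))// ler_wpM2l ?powR_ge0//.
    apply: (@le_trans _ _ ((t i `^ p^-1 * s i `^ q^-1) `^ (p - 1))).
      rewrite ge0_ler_powR ?nnegrE ?mulr_ge0 ?powR_ge0 ?(ltW (e0 _))//.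
      by rewrite subr_ge0 (ltW (conjugate_gt1 p0 q0 pq)).
    rewrite powRM ?powR_ge0// -!powRrM.
    have -> : p^-1 * (p - 1) = q^-1.
      by rewrite mulrBr mulr1 mulVf ?gt_eqF// -pq; ring.
    have -> // : q^-1 * (p - 1) = p - 2 + p^-1.
    rewrite (_ : q^-1 = 1 - p^-1) ?mulrBl ?mulrBr ?mulVf ?gt_eqF//; first by ring.
    by rewrite -pq; ring.
  have -> : s i `^ p^-1 = s i `^ (p - 2 + p^-1) * s i `^ (2 - p).
    rewrite -powRD; last by apply/implyP => _; rewrite lt0r_neq0.
    by congr (_ `^ _); ring.
  have -> : L `^ p * (mu i `^ (p - 1) * mu i) * s i `^ (2 - p) =
    mu i `^ (p - 1) * (L `^ p * mu i * s i `^ (2 - p)) by ring.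
  have -> : 2 `^ (p - 1) * L `^ p *
     (s i `^ (p - 2 + p^-1) * s i `^ (2 - p) * t i `^ q^-1) * mu i =
    2 `^ (p - 1) * (t i `^ q^-1 * s i `^ (p - 2 + p^-1)) *
    (L `^ p * mu i * s i `^ (2 - p)) by ring.
  by rewrite ler_wpM2r// !mulr_ge0 ?powR_ge0// ltW.
(* Averages with respect to [s] and [t]; their maximal bounds in [L^p(s)] and [L^q(t)] supply the
   factors [q] and [p] of the constant. *)
pose A i := below a i / below s i; pose C i := below c i / below t i.
have A0 i : 0 <= A i by rewrite divr_ge0 ?(ltW (S_gt0 _))// sumr_ge0.
have C0 i : 0 <= C i by rewrite divr_ge0 ?(ltW (T_gt0 _))// sumr_ge0.
apply: (@le_trans _ _ (\sum_i (2 `^ (p - 1) * L `^ p) *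
    ((A i * s i `^ p^-1) * (C i * t i `^ q^-1)))).
  apply: ler_sum => i _.
  have -> : below a i * below c i / mu i =
      A i * C i * (below s i * below t i / mu i).
    rewrite /A /C; field.
    by rewrite ?gt_eqF.
  have -> : 2 `^ (p - 1) * L `^ p * (A i * s i `^ p^-1 * (C i * t i `^ q^-1)) =
    A i * C i * (2 `^ (p - 1) * L `^ p * (s i `^ p^-1 * t i `^ q^-1)) by ring.
  by rewrite ler_wpM2l// mulr_ge0.
rewrite -mulr_sumr.
have hA := @forest_maximal_bound p q p0 q0 pq s a b s0 a0 b0 ab.
have hC := @forest_maximal_bound q p q0 p0 qp t c d t0 c0 d0 cd.
have -> : p * q * 2 `^ (p - 1) * L `^ p * (\sum_i b i) `^ p^-1 *
    (\sum_i d i) `^ q^-1 = 2 `^ (p - 1) * L `^ p *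
    ((q * (\sum_i b i) `^ p^-1) * (p * (\sum_i d i) `^ q^-1)) by ring.
rewrite ler_wpM2l ?mulr_ge0 ?powR_ge0//.
apply: le_trans (hoelder_sum p0 q0 pq _ _ _ _) _.
- by move=> i; rewrite mulr_ge0 ?powR_ge0.
- by move=> i; rewrite mulr_ge0 ?powR_ge0.
rewrite ler_pM ?powR_ge0//.
  under eq_bigr do rewrite powRM ?powR_ge0// powRVK ?(ltW (s0 _))//.
  exact: hA.
under eq_bigr do rewrite powRM ?powR_ge0// powRVK ?(ltW (t0 _))//.
exact: hC.
Qed.

End bilinear.

(** With [L = K^(1/p)], the case [p >= 2] yields [L^p = K] and [2^(p-1) = 2^(p/q)], the dual case
    [L^q = K^(q/p)] and [2^(q-1) = 2^(q/p)]. As [p/q] and [q/p] are inverse to each other, the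
    maxima select the right case. *)
Lemma sparse_form_bound (e mu t s : I -> R) (p q K : R) (a b c d : I -> R) :
  (forall i, 0 < e i) -> (forall i, 0 < mu i) ->
  (forall i, mu i <= 2 * e i) ->
  (forall i, 0 < t i) -> (forall i, 0 < s i) ->
  0 < p -> 0 < q -> p^-1 + q^-1 = 1 -> 0 <= K ->
  (forall i, e i <= t i `^ p^-1 * s i `^ q^-1) ->
  (forall i, below t i `^ p^-1 * below s i `^ q^-1 <= K `^ p^-1 * mu i) ->
  (forall i, 0 <= a i) -> (forall i, 0 <= b i) ->
  (forall i, 0 <= c i) -> (forall i, 0 <= d i) ->
  (forall i, a i <= b i `^ p^-1 * s i `^ q^-1) ->
  (forall i, c i <= d i `^ q^-1 * t i `^ p^-1) ->
  \sum_i below a i * below c i / mu i <=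
  p * q * 2 `^ Num.max (p / q) (q / p) * K `^ Num.max 1 (q / p) *
    (\sum_i b i) `^ p^-1 * (\sum_i d i) `^ q^-1.
Proof.
move=> e0 mu0 mu_e t0 s0 p0 q0 pq K0 ets TSK a0 b0 c0 d0 ab cd.
have qp : q^-1 + p^-1 = 1 by rewrite addrC.
have uv : p / q * (q / p) = 1 by rewrite mulrA divfK ?gt_eqF// mulfV ?gt_eqF.
have v0 : 0 < q / p by rewrite divr_gt0.
case: (lerP 2 p) => p2.
  have u1 : 1 <= p / q by rewrite (conjugate_div p0 q0 pq); lra.
  have v1 : q / p <= 1 by rewrite -uv ler_peMl// ltW.
  rewrite max_l ?(le_trans v1)// max_l// (conjugate_div p0 q0 pq).
  have := sparse_form_bound_ge2 e0 mu0 mu_e t0 s0 p0 q0 pq p2 ets TSK a0 b0 c0 d0 ab cd.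
  by rewrite powRVK// powRr1.
have u1 : p / q < 1 by rewrite (conjugate_div p0 q0 pq); lra.
have v1 : 1 < q / p by rewrite -uv gtr_pMl.
have q2 : 2 <= q by move: (ltW v1); rewrite (conjugate_div q0 p0 qp); lra.
(* The form is symmetric under exchanging (p, s, a, b) and (q, t, c, d). *)
rewrite max_r ?(ltW (lt_trans u1 v1))// max_r ?(ltW v1)//.
have ets' i : e i <= s i `^ q^-1 * t i `^ p^-1 by rewrite mulrC.
have TSK' i : below s i `^ q^-1 * below t i `^ p^-1 <= K `^ p^-1 * mu i.
  by rewrite mulrC.
have := sparse_form_bound_ge2 e0 mu0 mu_e s0 t0 q0 p0 qp q2 ets' TSK' c0 d0 a0 b0 cd ab.
rewrite -powRrM [p^-1 * q]mulrC -(conjugate_div q0 p0 qp) [q * p]mulrC.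
rewrite mulrAC; under eq_bigr do rewrite [below c _ * _]mulrC.
by [].
Qed.

(** The inner sum is the value of the sparse operator on the core of [i], so the left-hand side is a
    weighted [L^p] norm. *)
Lemma sparse_sum_bound (e mu t s : I -> R) (p q K : R) (a b : I -> R) :
  (forall i, 0 < e i) -> (forall i, 0 < mu i) ->
  (forall i, mu i <= 2 * e i) ->
  (forall i, 0 < t i) -> (forall i, 0 < s i) ->
  0 < p -> 0 < q -> p^-1 + q^-1 = 1 -> 0 <= K ->
  (forall i, e i <= t i `^ p^-1 * s i `^ q^-1) ->
  (forall i, below t i `^ p^-1 * below s i `^ q^-1 <= K `^ p^-1 * mu i) ->
  (forall i, 0 <= a i) -> (forall i, 0 <= b i) ->
  (forall i, a i <= b i `^ p^-1 * s i `^ q^-1) ->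
  (\sum_i (\sum_(k | le i k) below a k / mu k) `^ p * t i) `^ p^-1 <=
  p * q * 2 `^ Num.max (p / q) (q / p) * K `^ Num.max 1 (q / p) *
    (\sum_i b i) `^ p^-1.
Proof.
move=> e0 mu0 mu_e t0 s0 p0 q0 pq K0 ets TSK a0 b0 ab.
(* Duality is realised by testing against the power [g `^ (p - 1)] itself. *)
pose g i := \sum_(k | le i k) below a k / mu k.
have g0 i : 0 <= g i.
  by apply: sumr_ge0 => k _; rewrite divr_ge0 ?(ltW (mu0 _))// sumr_ge0.
have d0 i : 0 <= g i `^ p * t i by rewrite mulr_ge0 ?powR_ge0// ltW.
have c0 i : 0 <= g i `^ (p - 1) * t i by rewrite mulr_ge0 ?powR_ge0// ltW.
(* In fact an equality, by [p/q = p - 1] and [1/p + 1/q = 1]. *)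
have cd i : g i `^ (p - 1) * t i <= (g i `^ p * t i) `^ q^-1 * t i `^ p^-1.
  rewrite powRM ?powR_ge0 ?(ltW (t0 i))// -powRrM (conjugate_div p0 q0 pq).
  rewrite -mulrA -powRD; last by apply/implyP => _; rewrite lt0r_neq0.
  by rewrite [q^-1 + _]addrC pq powRr1 ?(ltW (t0 i)).
have := sparse_form_bound e0 mu0 mu_e t0 s0 p0 q0 pq K0 ets TSK a0 b0 c0 d0 ab cd.
(* Exchanging the sums collects the terms with [le i k] into [g i], so the tested form becomes the
   quantity to be bounded. *)
have -> : \sum_i below a i * below (fun i => g i `^ (p - 1) * t i) i / mu i =
    \sum_i g i `^ p * t i.
  under eq_bigr do rewrite mulrAC /below mulr_sumr.
  rewrite (exchange_big_dep xpredT)//=; apply: eq_bigr => i _.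
  by rewrite -mulr_suml -/(g i) mulrA mulr_powRB1.
apply: le_powRV_absorb => //.
  exact: sumr_ge0.
by rewrite !mulr_ge0 ?powR_ge0// ltW.
Qed.

End forest.

Local Open Scope classical_set_scope.
Local Open Scope ring_scope.

(** * Families of sets in a measure space *)

Section hoelder_on_sets.
Context d (T : measurableType d) (R : realType) (mu : {measure set T -> \bar R}).
Local Open Scope ereal_scope.

Lemma hoelder_on (A : set T) (g h : T -> R) (p q : R) :
  measurable A -> measurable_fun setT g -> measurable_fun setT h ->
  (forall x, 0 <= g x)%R -> (forall x, 0 <= h x)%R ->
  (0 < p)%R -> (0 < q)%R -> (p^-1 + q^-1 = 1)%R ->
  \int[mu]_(x in A) (g x * h x)%:E <=
  (\int[mu]_(x in A) (g x `^ p)%:E) `^ p^-1 *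
  (\int[mu]_(x in A) (h x `^ q)%:E) `^ q^-1.
Proof.
move=> mA mg mh g0 h0 p0 q0 pq.
have mr (f : T -> R) : measurable_fun setT f -> measurable_fun setT (f \_ A).
  move=> mf; apply/(measurable_restrictT _ _).1 => //.
  exact: measurable_funS mf.
have Lr (f : T -> R) r : (0 < r)%R -> (forall x, 0 <= f x)%R ->
    'N[mu]_r%:E[EFin \o (f \_ A)] = (\int[mu]_(x in A) (f x `^ r)%:E) `^ r^-1.
  move=> r0 f0; rewrite unlock/= [in RHS]integral_mkcond; congr (_ `^ _).
  apply: eq_integral => x _ /=; rewrite !patchE; case: ifPn => xA /=.
    by rewrite ger0_norm.
  by rewrite normr0 powR0// gt_eqF.
have := hoelder mu (mr _ mg) (mr _ mh) p0 q0 pq.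
rewrite !Lr// Lnorm1; apply: le_trans.
rewrite integral_mkcond le_eqVlt; apply/orP; left; apply/eqP.
apply: eq_integral => x _ /=; rewrite !patchE; case: ifPn => xA /=.
  by rewrite ger0_norm// mulr_ge0.
by rewrite mul0r normr0.
Qed.

End hoelder_on_sets.

(** * Countability of disjoint families of positive measure *)

Section disjoint_positive_families.
Context d (T : measurableType d) (R : realType) (mu : {measure set T -> \bar R}).
Local Open Scope ereal_scope.

(** More than [mu F / r] members would occupy disjoint pieces of [F] of total measure above
    [mu F]. *)
Lemma finite_trivIset_measure (C : set (set T)) (F : set T) (r : R) :
  (0 < r)%R -> trivIset C id -> measurable F -> mu F < +oo ->
  (forall A, C A -> measurable A /\ r%:E <= mu (A `&` F)) -> finite_set C.
Proof.
move=> r0 tC mF Foo CA; apply: contrapT => infC.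
have [n] : exists n : nat, mu F < (n%:R * r)%:E.
  exists (Num.truncn (fine (mu F) / r)).+1.
  rewrite -[ltLHS]fineK ?ge0_fin_numE// lte_fin -ltr_pdivrMr//.
  by rewrite truncnS_gt.
apply/negP; rewrite -leNgt.
have [B BC nB] := infinite_set_fset n infC.
have mB A : A \in B -> measurable (A `&` F).
  by move=> /BC /CA[mA _]; exact: measurableI.
have tB : trivIset [set` B] (fun A => A `&` F).
  move=> A A' /BC CA0 /BC CA1 [x [[Ax _] [A'x _]]].
  by apply: tC => //; exists x.
apply: (@le_trans _ _ (\sum_(A <- B) mu (A `&` F))).
  apply: (@le_trans _ _ (\sum_(A <- B) r%:E)).
    rewrite sumEFin lee_fin big_const_seq count_predT iter_addr_0 mulr_natl.
    by rewrite ler_wpMn2l// ltW.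
  by rewrite big_seq [leRHS]big_seq; apply: lee_sum => A /BC /CA[].
rewrite -measure_fbigsetU//; apply: le_measure; rewrite ?inE//.
  by rewrite big_seq; apply: bigsetU_measurable.
by rewrite -bigcup_fset; apply: bigcup_sub => A _; exact: subIsetr.
Qed.

(** Each member meets some [F i] of a sigma-finite cover in measure at least [1/(k+1)], and for
    fixed [i] and [k] only finitely many members do. *)
Lemma countable_trivIset_measure (C : set (set T)) : sigma_finite setT mu ->
  trivIset C id -> (forall A, C A -> measurable A /\ 0 < mu A) -> countable C.
Proof.
move=> [F TF mF] tC CA.
pose D (ik : nat * nat) :=
  [set A | C A /\ (ik.2.+1%:R^-1)%:E <= mu (A `&` F ik.1)].
have CD : C `<=` \bigcup_(ik in setT) D ik.
  move=> A AC; have [mA A0] := CA _ AC.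
  have [i Ai] : exists i, 0 < mu (A `&` F i).
    apply: contrapT => /forallNP h; move: A0; rewrite lt_neqAle => /andP[/eqP + _].
    apply; apply/esym; apply/(negligibleP mu mA).
    rewrite -[A]setIT TF setI_bigcupr; apply: negligible_bigcup => i.
    apply/(negligibleP mu); first by apply: measurableI => //; exact: (mF i).1.
    by apply/eqP; rewrite -measure_le0 leNgt; exact/negP/h.
  have fAi : mu (A `&` F i) \is a fin_num.
    rewrite ge0_fin_numE// (le_lt_trans _ (mF i).2)//.
    by rewrite measureIr//; exact: (mF i).1.
  move: Ai; rewrite -(fineK fAi) lte_fin => /ltr_add_invr[k]; rewrite add0r => hk.
  by exists (i, k) => //; split => //=; rewrite -(fineK fAi) lee_fin ltW.
apply: (sub_countable (subset_card_le CD)).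
apply: bigcup_countable => // -[i k] _; apply: finite_set_countable.
have [mFi Fioo] := mF i.
apply: (@finite_trivIset_measure _ (F i) k.+1%:R^-1) => //.
- by apply: sub_trivIset tC => A [].
- by move=> A [/CA[mA _] ?].
Qed.

End disjoint_positive_families.

(** * Cores of a finite nested family and integrals over them *)

Section forest_of_sets.
Context d (T : measurableType d) (R : realType) (mu : {measure set T -> \bar R}).
Variables (I : finType) (Q : I -> set T).
Hypotheses (mQ : forall i, measurable (Q i)) (injQ : injective Q)
  (nestQ : forall i j, Q i `&` Q j !=set0 -> Q i `<=` Q j \/ Q j `<=` Q i).
Local Open Scope ereal_scope.

Definition leset (i j : I) := `[< Q i `<=` Q j >].

Definition core (i : I) :=
  Q i `\` \big[setU/set0]_(j | `[< Q j `<` Q i >]) Q j.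

Lemma leset_refl : reflexive leset.
Proof. by move=> i; apply/asboolP. Qed.

Lemma leset_trans : transitive leset.
Proof. by move=> j i k /asboolP ij /asboolP jk; apply/asboolP/(subset_trans ij). Qed.

Lemma leset_forest i j k : Q i !=set0 ->
  leset i j -> leset i k -> leset j k || leset k j.
Proof.
move=> [x Qix] /asboolP ij /asboolP ik.
have /nestQ[jk|kj] : Q j `&` Q k !=set0 by exists x; split; [exact: ij|exact: ik].
  by apply/orP; left; apply/asboolP.
by apply/orP; right; apply/asboolP.
Qed.

Lemma measurable_core i : measurable (core i).
Proof. by apply: measurableD => //; exact: bigsetU_measurable. Qed.

Lemma core_sub i : core i `<=` Q i.
Proof. exact: subDsetl. Qed.

(** Nestedness makes the members containing a point a chain; the core of [i] is where [Q i] is least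
    in that chain. *)
Lemma coreP i x : core i x <-> Q i x /\ forall j, Q j x -> Q i `<=` Q j.
Proof.
rewrite /core -bigcup_seq_cond; split => [[Qix nx]|[Qix h]].
  split => // j Qjx.
  have /nestQ[//|ji] : Q i `&` Q j !=set0 by exists x.
  apply: contrapT => nij; apply: nx; exists j => //=.
  by rewrite mem_index_enum /=; apply/asboolP; split.
split => // -[j /=]; rewrite mem_index_enum /= => /asboolP[_ nij] Qjx.
exact/nij/h.
Qed.

(** Hence the indicator of every member is constant on every core, which turns integrals into sums
    over the forest. *)
Lemma core_mem i j x : core j x -> Q i x <-> leset j i.
Proof.
move=> /coreP[Qjx h]; split => [/h ji|/asboolP]; last exact.
exact/asboolP.
Qed.

Lemma trivIset_core : trivIset setT core.
Proof.
move=> i j _ _ [x [xi xj]]; apply: injQ; apply/seteqP.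
have [Qix _] := (coreP _ _).1 xi; have [Qjx _] := (coreP _ _).1 xj.
by split; apply/asboolP; [apply/(core_mem j xi)|apply/(core_mem i xj)].
Qed.

Lemma exists_core i x : Q i x -> exists j, core j x.
Proof.
move=> Qix; have Pi : `[< Q i x >] by exact/asboolP.
(* The least member containing [x] is the one with the fewest members inside it. *)
case: (@arg_minnP _ i (fun k => `[< Q k x >]) (fun j => #|[pred k | leset k j]|) Pi)
  => j /asboolP Qjx jmin.
exists j; apply/coreP; split => // k Qkx.
have /nestQ[//|kj] : Q j `&` Q k !=set0 by exists x.
have sub : [pred l | leset l k] \subset [pred l | leset l j].
  by apply/fintype.subsetP => l; rewrite !inE => lk y /lk /kj.
have [_] := subset_leqif_card sub; rewrite eqn_leq subset_leq_card//=.
rewrite jmin; last exact/asboolP.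
by move=> /esym/fintype.subsetP/(_ j); rewrite !inE => /(_ (@subset_refl _ _)).
Qed.

Lemma bigsetU_core i : Q i = \big[setU/set0]_(j | leset j i) core j.
Proof.
rewrite -bigcup_seq_cond; apply/seteqP; split => [x Qix|x [j /=]].
  have [j jx] := exists_core Qix; exists j => //=.
  by rewrite mem_index_enum; apply/(core_mem i jx).
by rewrite mem_index_enum /= => ji jx; apply/(core_mem i jx).
Qed.

Lemma integral_cores (P : pred I) (h : T -> \bar R) :
  measurable_fun setT h -> (forall x, 0 <= h x) ->
  \int[mu]_(x in \big[setU/set0]_(j | P j) core j) h x =
  \sum_(j | P j) \int[mu]_(x in core j) h x.
Proof.
move=> mh h0; rewrite -big_filter ge0_integral_bigsetU//.
- by rewrite big_filter.
- by move=> i; exact: measurable_core.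
- by rewrite filter_uniq// index_enum_uniq.
- exact: sub_trivIset trivIset_core.
- exact: measurable_funS mh.
Qed.

Lemma integral_forest i (h : T -> \bar R) :
  measurable_fun setT h -> (forall x, 0 <= h x) ->
  \int[mu]_(x in Q i) h x < +oo ->
  (forall j, \int[mu]_(x in core j) h x \is a fin_num) ->
  fine (\int[mu]_(x in Q i) h x) =
  below leset (fun j => fine (\int[mu]_(x in core j) h x)) i.
Proof.
move=> mh h0 hoo hfin; apply: EFin_inj; rewrite fineK ?ge0_fin_numE ?integral_ge0//.
rewrite bigsetU_core integral_cores// -sumEFin.
by apply: eq_bigr => j _; rewrite fineK.
Qed.

(** On [core j] the step function is the sum of the [g i] with [i] above [j]. Off all members it
    vanishes, and so does its power because [p > 0]. *)
Lemma integral_step_power (g : I -> R) (h : T -> R) (p : R) : (0 < p)%R ->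
  (forall i, 0 <= g i)%R ->
  measurable_fun setT h -> (forall x, 0 <= h x)%R ->
  (forall j, \int[mu]_(x in core j) (h x)%:E \is a fin_num) ->
  \int[mu]_x ((\sum_i g i * \1_(Q i) x) `^ p * h x)%:E =
  (\sum_j (\sum_(i | leset j i) g i) `^ p *
     fine (\int[mu]_(x in core j) (h x)%:E))%:E.
Proof.
move=> p0 g0 mh h0 hfin.
pose F x := ((\sum_i g i * \1_(Q i) x) `^ p * h x)%R.
have F0 x : (0 <= F x)%R by rewrite mulr_ge0// powR_ge0.
have mF : measurable_fun setT F.
  apply: measurable_funM => //; apply: (measurableT_comp (measurable_powR p)).
  by apply: measurable_sum => i; exact: measurable_funM.
pose U := \big[setU/set0]_(j | xpredT j) core j.
transitivity (\int[mu]_(x in U) (F x)%:E).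
  rewrite [in RHS]integral_mkcond; apply: eq_integral => x _.
  rewrite patchE; case: ifPn => // /negP xU; congr EFin.
  rewrite big1 ?powR0 ?mul0r ?gt_eqF// => i _.
  rewrite indicE memNset ?mulr0// => Qix; apply: xU; rewrite inE.
  have [j jx] := exists_core Qix.
  by rewrite /U -bigcup_seq_cond; exists j => //=; rewrite mem_index_enum.
rewrite integral_cores//; last exact/measurable_EFinP.
rewrite -sumEFin; apply: eq_bigr => j _.
have h0j x : core j x -> 0 <= (h x)%:E by rewrite lee_fin.
have mhj : measurable_fun (core j) (EFin \o h).
  by apply/measurable_EFinP; exact: measurable_funS mh.
rewrite EFinM (fineK (hfin j)).
rewrite -(ge0_integralZl_EFin mu (measurable_core j) h0j mhj (powR_ge0 _ _)).
apply: eq_integral => x /[!inE] xj; rewrite -EFinM /F; congr (EFin (_ `^ _ * _)%R).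
rewrite [LHS](bigID (leset j))/= [X in (_ + X)%R]big1 ?addr0.
  apply: eq_bigr => i ji; rewrite indicE mem_set ?mulr1//.
  exact/(core_mem i xj).
move=> i nji; rewrite indicE memNset ?mulr0// => /(core_mem i xj) ji.
by rewrite ji in nji.
Qed.

End forest_of_sets.

(** * Hoelder's inequality with a weight and its dual *)

Section weighted_hoelder.
Context d (T : measurableType d) (R : realType) (mu : {measure set T -> \bar R}).
Variables (v : T -> R) (p q : R).
Hypotheses (mv : measurable_fun setT v) (v0 : forall x, (0 < v x)%R).
Hypotheses (p0 : (0 < p)%R) (q0 : (0 < q)%R) (pq : (p^-1 + q^-1 = 1)%R).
Local Open Scope ereal_scope.

(** Hoelder for [f = (f v^(1/p)) * v^(-1/p)]; the dual exponent is [-q/p = 1 - q]. *)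
Lemma hoelder_weight (A : set T) (f : T -> R) :
  measurable A -> measurable_fun setT f -> (forall x, 0 <= f x)%R ->
  \int[mu]_(x in A) (f x)%:E <=
  (\int[mu]_(x in A) (f x `^ p * v x)%:E) `^ p^-1 *
  (\int[mu]_(x in A) (v x `^ (1 - q))%:E) `^ q^-1.
Proof.
move=> mA mf f0.
have qp : (q^-1 + p^-1 = 1)%R by rewrite addrC.
have := @hoelder_on _ _ _ mu A (fun x => f x * v x `^ p^-1)%R
  (fun x => v x `^ (- p^-1))%R p q mA.
have -> : \int[mu]_(x in A) (f x * v x `^ p^-1 * v x `^ (- p^-1))%:E =
    \int[mu]_(x in A) (f x)%:E.
  apply: eq_integral => x _; rewrite -mulrA -powRD ?subrr ?powRr0 ?mulr1//.
  by apply/implyP => _; rewrite lt0r_neq0.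
have -> : \int[mu]_(x in A) ((f x * v x `^ p^-1) `^ p)%:E =
    \int[mu]_(x in A) (f x `^ p * v x)%:E.
  by apply: eq_integral => x _; rewrite powRM ?powR_ge0// powRVK// ltW.
have -> : \int[mu]_(x in A) ((v x `^ (- p^-1)) `^ q)%:E =
    \int[mu]_(x in A) (v x `^ (1 - q))%:E.
  apply: eq_integral => x _; rewrite -powRrM; congr (_ `^ _)%:E.
  by rewrite mulNr mulrC (conjugate_div q0 p0 qp) opprB.
have mpow r : measurable_fun setT (fun x => v x `^ r)%R.
  exact: (measurableT_comp (measurable_powR r)).
apply => //; first exact: measurable_funM.
- by move=> x; rewrite mulr_ge0 ?powR_ge0.
- by move=> x; exact: powR_ge0.
Qed.

Lemma hoelder_weight_measure (A : set T) : measurable A ->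
  mu A <= (\int[mu]_(x in A) (v x)%:E) `^ p^-1 *
          (\int[mu]_(x in A) (v x `^ (1 - q))%:E) `^ q^-1.
Proof.
move=> mA; have := @hoelder_weight A (cst 1%R) mA.
have -> : \int[mu]_(x in A) (cst 1%R x)%:E = mu A.
  by rewrite -[RHS]mul1e -(integral_cst mu mA 1).
have -> : \int[mu]_(x in A) (cst 1%R x `^ p * v x)%:E = \int[mu]_(x in A) (v x)%:E.
  by apply: eq_integral => x _; rewrite powR1 mul1r.
by apply.
Qed.

(** As [0 * +oo = 0], a finite product does not make its factors finite. Hoelder and [0 < mu A]
    first show that both factors are positive. *)
Lemma Ap_integrals_fin (A : set T) (L : R) : measurable A ->
  0 < mu A < +oo ->
  (\int[mu]_(x in A) (v x)%:E) `^ p^-1 *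
  (\int[mu]_(x in A) (v x `^ (1 - q))%:E) `^ q^-1 <= L%:E * mu A ->
  \int[mu]_(x in A) (v x)%:E < +oo /\
  \int[mu]_(x in A) (v x `^ (1 - q))%:E < +oo.
Proof.
move=> mA /andP[A0 Aoo] h.
have := hoelder_weight_measure mA.
move: h; set X := \int[mu]_(x in A) _; set Y := \int[mu]_(x in A) _.
have X0 : 0 <= X by apply: integral_ge0 => x _; rewrite lee_fin ltW.
have Y0 : 0 <= Y by apply: integral_ge0 => x _; rewrite lee_fin powR_ge0.
have fA : mu A \is a fin_num by rewrite ge0_fin_numE.
move=> h /(lt_le_trans A0) XY0.
have XYoo : X `^ p^-1 * Y `^ q^-1 < +oo.
  by rewrite (le_lt_trans h)// -(fineK fA) -EFinM ltry.
have Xp : 0 < X `^ p^-1.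
  rewrite lt_neqAle poweR_ge0 andbT; apply/eqP => X'.
  by move: XY0; rewrite -X' mul0e ltxx.
have Yq : 0 < Y `^ q^-1.
  rewrite lt_neqAle poweR_ge0 andbT; apply/eqP => X'.
  by move: XY0; rewrite -X' mule0 ltxx.
split; rewrite ltey; apply/eqP => E; move: XYoo.
  by rewrite E poweRyr ?gt_eqF ?invr_gt0// gt0_mulye.
by rewrite E [X in _ * X]poweRyr ?gt_eqF ?invr_gt0// gt0_muley.
Qed.

End weighted_hoelder.

(** * The estimate for finite subfamilies *)

Section sparse_families.
Context d (T : measurableType d) (R : realType) (mu : {measure set T -> \bar R}).
Variables (v : T -> R) (p q K : R) (S : set (set T)).
Hypotheses (mv : measurable_fun setT v) (v0 : forall x, (0 < v x)%R).
Hypotheses (p0 : (0 < p)%R) (q0 : (0 < q)%R) (pq : (p^-1 + q^-1 = 1)%R).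
Hypothesis K0 : (0 <= K)%R.
Local Open Scope ereal_scope.
Hypotheses (mS : forall Q, S Q -> measurable Q)
  (S_fin : forall Q, S Q -> 0 < mu Q < +oo)
  (S_nest : forall P Q, S P -> S Q -> P `&` Q !=set0 -> P `<=` Q \/ Q `<=` P)
  (S_sparse : forall (r : seq (set T)) Q, S Q ->
     (forall P, P \in r -> S P /\ P `<` Q) ->
     mu (\big[setU/set0]_(P <- r) P) <= (2^-1)%:E * mu Q)
  (S_Ap : forall Q, S Q ->
     (\int[mu]_(x in Q) (v x)%:E) `^ p^-1 *
     (\int[mu]_(x in Q) (v x `^ (1 - q))%:E) `^ q^-1 <= (K `^ p^-1)%:E * mu Q).
Variable f : T -> R.
Hypotheses (mf : measurable_fun setT f) (f0 : forall x, (0 <= f x)%R).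
Hypothesis f_fin : \int[mu]_x (f x `^ p * v x)%:E < +oo.

Let C := (p * q * 2 `^ Num.max (p / q) (q / p) * K `^ Num.max 1 (q / p))%R.

Let fpv_ge0 x : (0 <= f x `^ p * v x)%R.
Proof. by rewrite mulr_ge0 ?powR_ge0// ltW. Qed.

Let mpow r : measurable_fun setT (fun x => v x `^ r)%R.
Proof. exact: (measurableT_comp (measurable_powR r)). Qed.

Let mfpv : measurable_fun setT (fun x => f x `^ p * v x)%R.
Proof. by apply: measurable_funM => //; exact: (measurableT_comp (measurable_powR p)). Qed.

Lemma sparse_integral_fin Q : S Q -> \int[mu]_(x in Q) (f x)%:E < +oo.
Proof.
move=> SQ; have mQ := mS SQ.
have [_ Yoo] := Ap_integrals_fin mv v0 p0 q0 pq mQ (S_fin SQ) (S_Ap SQ).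
apply: (le_lt_trans (hoelder_weight mu mv v0 p0 q0 pq mQ mf f0)).
rewrite lte_mul_pinfty ?poweR_ge0 ?poweR_lty//.
rewrite fin_num_poweR// ge0_fin_numE; last first.
  by apply: integral_ge0 => x _; rewrite lee_fin.
rewrite (le_lt_trans _ f_fin)// ge0_subset_integral//.
- exact/measurable_EFinP.
- by move=> x _; rewrite lee_fin.
Qed.

(** Reduction to [sparse_sum_bound]: nodes are positions in [r] ordered by inclusion of the sets,
    and the data are integrals over cores. *)
Lemma sparse_finite_bound (r : seq (set T)) : uniq r ->
  (forall Q, Q \in r -> S Q) ->
  (\int[mu]_x ((\sum_(Q <- r) fine (\int[mu]_(y in Q) (f y)%:E) / fine (mu Q) *
     \1_Q x) `^ p * v x)%:E) `^ p^-1 <=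
  C%:E * (\int[mu]_x (f x `^ p * v x)%:E) `^ p^-1.
Proof.
move=> ur rS.
pose Q (i : 'I_(size r)) := nth set0 r i.
have SQ i : S (Q i) by apply/rS/mem_nth.
have mQ i : measurable (Q i) by exact/mS.
have injQ : injective Q.
  by move=> i j /eqP; rewrite nth_uniq// => /eqP/val_inj.
have nestQ i j : Q i `&` Q j !=set0 -> Q i `<=` Q j \/ Q j `<=` Q i.
  exact: S_nest.
have mE i := measurable_core mQ i.
have EQ i : core Q i `<=` Q i by exact: core_sub.
have fin_core (h : T -> R) i : measurable_fun setT h -> (forall x, 0 <= h x)%R ->
    \int[mu]_(x in Q i) (h x)%:E < +oo ->
    \int[mu]_(x in core Q i) (h x)%:E \is a fin_num.
  move=> mh h0 hoo; rewrite ge0_fin_numE; last first.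
    by apply: integral_ge0 => x _; rewrite lee_fin.
  rewrite (le_lt_trans _ hoo)// ge0_subset_integral//.
  - by apply/measurable_EFinP; exact: measurable_funS mh.
  - by move=> x _; rewrite lee_fin.
have Xfin i := (Ap_integrals_fin mv v0 p0 q0 pq (mQ i) (S_fin (SQ i)) (S_Ap (SQ i))).1.
have Yfin i := (Ap_integrals_fin mv v0 p0 q0 pq (mQ i) (S_fin (SQ i)) (S_Ap (SQ i))).2.
have afin i := sparse_integral_fin (SQ i).
have bfin i : \int[mu]_(x in Q i) (f x `^ p * v x)%:E < +oo.
  rewrite (le_lt_trans _ f_fin)// ge0_subset_integral//.
  - exact/measurable_EFinP.
  - by move=> x _; rewrite lee_fin.
have w0 x : (0 <= v x `^ (1 - q))%R by exact: powR_ge0.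
have v0' x : (0 <= v x)%R by exact/ltW.
pose e i := fine (mu (core Q i)); pose m i := fine (mu (Q i)).
pose t i := fine (\int[mu]_(x in core Q i) (v x)%:E).
pose s i := fine (\int[mu]_(x in core Q i) (v x `^ (1 - q))%:E).
pose a i := fine (\int[mu]_(x in core Q i) (f x)%:E).
pose b i := fine (\int[mu]_(x in core Q i) (f x `^ p * v x)%:E).
have tE i := fineK (fin_core _ i mv v0' (Xfin i)).
have sE i := fineK (fin_core _ i (mpow _) w0 (Yfin i)).
have aE i := fineK (fin_core _ i mf f0 (afin i)).
have bE i := fineK (fin_core _ i mfpv fpv_ge0 (bfin i)).
have mfin i : mu (Q i) \is a fin_num.
  by rewrite ge0_fin_numE//; have /andP[] := S_fin (SQ i).
have mE' i := fineK (mfin i).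
have efin i : mu (core Q i) \is a fin_num.
  have /andP[_] := S_fin (SQ i).
  rewrite ge0_fin_numE//; apply: le_lt_trans.
  by apply: le_measure => //; rewrite inE.
have eE i := fineK (efin i).
have m0 i : (0 < m i)%R.
  by rewrite -lte_fin mE'; have /andP[] := S_fin (SQ i).
(* [Q i] is its core together with the strictly smaller members, which fill at most half of it by
   sparseness. *)
have m2e i : (m i <= 2 * e i)%R.
  have : mu (Q i) <= mu (core Q i) + (2^-1)%:E * mu (Q i).
    pose U := \big[setU/set0]_(j | `[< Q j `<` Q i >]) Q j.
    have mU : measurable U by exact: bigsetU_measurable.
    rewrite [leLHS](measureDI mu (mQ i) mU) leeD//.
    have -> : Q i `&` U = U.
      apply/setIidPr; rewrite /U -bigcup_seq_cond => x [j /= /andP[_ /asboolP[ji _]]].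
      exact: ji.
    have := @S_sparse [seq Q j | j <- index_enum 'I_(size r) & `[< Q j `<` Q i >]]
      (Q i) (SQ i).
    rewrite big_map big_filter; apply => P /mapP[j].
    by rewrite mem_filter => /andP[/asboolP ? _] ->.
  rewrite -[mu (Q i)]mE' -[mu (core Q i)]eE -EFinM -EFinD lee_fin.
  by rewrite -/(m i) -/(e i); lra.
have e0 i : (0 < e i)%R by have := m2e i; have := m0 i; lra.
have nn (h : T -> R) i : (forall x, 0 <= h x)%R ->
    (0 <= fine (\int[mu]_(x in core Q i) (h x)%:E))%R.
  by move=> h0; rewrite fine_ge0// integral_ge0// => x _; rewrite lee_fin.
have t0 i : (0 <= t i)%R by exact: nn.
have s0 i : (0 <= s i)%R by exact: nn.
have ets i : (e i <= t i `^ p^-1 * s i `^ q^-1)%R.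
  rewrite -lee_fin EFinM -!poweR_EFin eE tE sE.
  exact: hoelder_weight_measure.
(* A core has positive measure, so by [ets] neither weight has zero mass on it. *)
have t1 i : (0 < t i)%R.
  rewrite lt_neqAle t0 andbT; apply/eqP => t'; have := ets i.
  by rewrite -t' powR0 ?gt_eqF ?invr_gt0// mul0r leNgt e0.
have s1 i : (0 < s i)%R.
  rewrite lt_neqAle s0 andbT; apply/eqP => t'; have := ets i.
  by rewrite -t' [X in (_ * X)%R]powR0 ?gt_eqF ?invr_gt0// mulr0 leNgt e0.
have ab i : (a i <= b i `^ p^-1 * s i `^ q^-1)%R.
  rewrite -lee_fin EFinM -!poweR_EFin aE bE sE.
  exact: hoelder_weight.
have bel (h : T -> R) i : measurable_fun setT h -> (forall x, 0 <= h x)%R ->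
    (forall j, \int[mu]_(x in Q j) (h x)%:E < +oo) ->
    fine (\int[mu]_(x in Q i) (h x)%:E) =
    below (leset Q) (fun j => fine (\int[mu]_(x in core Q j) (h x)%:E)) i.
  move=> mh h0 hoo; apply: integral_forest => //.
  - exact/measurable_EFinP.
  - by move=> j; exact: fin_core.
have TSK i : (below (leset Q) t i `^ p^-1 * below (leset Q) s i `^ q^-1 <=
    K `^ p^-1 * m i)%R.
  rewrite /t /s -!bel// -lee_fin !EFinM -!poweR_EFin mE' !fineK.
  - rewrite poweR_EFin; exact: S_Ap.
  - by rewrite ge0_fin_numE// integral_ge0// => x _; rewrite lee_fin.
  - by rewrite ge0_fin_numE// integral_ge0// => x _; rewrite lee_fin.
have a0 i : (0 <= a i)%R by exact: nn.
have b0 i : (0 <= b i)%R by exact: nn.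
have forest i j k : leset Q i j -> leset Q i k -> leset Q j k || leset Q k j.
  apply: leset_forest => //; apply/set0P/eqP => Q0.
  by have := m0 i; rewrite /m Q0 measure0 ltxx.
have := @sparse_sum_bound R _ (leset Q) (leset_refl Q) (@leset_trans _ _ _ Q)
  forest e m t s p q K a b e0 m0 m2e t1 s1 p0 q0 pq K0 ets TSK a0 b0 ab.
pose g i := (below (leset Q) a i / m i)%R.
have g0 i : (0 <= g i)%R by rewrite divr_ge0 ?(ltW (m0 i))// sumr_ge0.
have -> : \int[mu]_x ((\sum_(P <- r) fine (\int[mu]_(y in P) (f y)%:E) /
    fine (mu P) * \1_P x) `^ p * v x)%:E =
    (\sum_j (\sum_(i | leset Q j i) g i) `^ p * t j)%:E.
  rewrite -(integral_step_power mQ injQ nestQ p0 g0 mv v0'); last first.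
    by move=> j; exact: fin_core.
  apply: eq_integral => x _; congr (EFin (_ `^ _ * _)%R).
  rewrite (big_nth set0) big_mkord; apply: eq_bigr => i _.
  by rewrite /g /a -bel.
rewrite poweR_EFin -lee_fin => /le_trans; apply.
rewrite EFinM lee_wpmul2l ?lee_fin ?mulr_ge0 ?powR_ge0 ?(ltW p0) ?(ltW q0)//.
rewrite -poweR_EFin gt0_ler_poweR ?invr_ge0 ?(ltW p0)//.
- by rewrite in_itv/= leey andbT lee_fin sumr_ge0.
- rewrite in_itv/= leey andbT integral_ge0// => x _.
  by rewrite lee_fin.
(* The cores are disjoint, so the sum of [b] is one integral over their union. *)
have <- : \int[mu]_(x in \big[setU/set0]_(j | xpredT j) core Q j)
    (f x `^ p * v x)%:E = (\sum_i b i)%:E.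
  rewrite integral_cores//.
  - by rewrite -sumEFin; apply: eq_bigr => i _; rewrite bE.
  - exact/measurable_EFinP.
rewrite ge0_subset_integral//.
- exact: bigsetU_measurable.
- exact/measurable_EFinP.
- by move=> x _; rewrite lee_fin.
Qed.

End sparse_families.

(** * From finite to countable families *)

Section countable_sums.
Context d (T : measurableType d) (R : realType).
Local Open Scope ereal_scope.

(** Indexing by a subset [P] of the naturals treats finite and infinite families alike. *)
Lemma countable_enumeration (U : pointedType) (S : set U) : countable S ->
  exists (e : nat -> U) (P : set nat), set_inj P e /\ S = e @` P.
Proof.
move=> /countable_injP[f finj].
pose e n := get [set x | S x /\ f x = n].
have eK x : S x -> e (f x) = x.
  move=> Sx; have [Se fe] : [set y | S y /\ f y = f x] (e (f x)).
    by apply: (@getPex _ [set y | S y /\ f y = f x]); exists x.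
  by apply: finj fe; rewrite inE.
exists e, (f @` S); split.
  by move=> _ _ /[!inE] -[x Sx <-] [y Sy <-]; rewrite !eK// => ->.
apply/seteqP; split => [x Sx|_ [_ [x Sx <-] <-]]; last by rewrite eK.
by exists (f x); [exists x|rewrite eK].
Qed.

Lemma measurable_countable_esum (U : pointedType) (S : set U)
    (h : U -> T -> \bar R) : countable S ->
  (forall i, S i -> measurable_fun setT (h i)) -> (forall i x, S i -> 0 <= h i x) ->
  measurable_fun setT (fun x => \esum_(i in S) h i x).
Proof.
move=> /countable_enumeration[e [P [einj ->]]] mh h0.
under eq_fun => x.
  rewrite esum_set_image//; last by move=> n Pn; apply: h0; exists n.
  over.
apply: (@ge0_emeasurable_sum _ _ _ setT (fun i => h (e i)) (mem P)).
- by move=> k x _ /set_mem Pk; apply: h0; exists k.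
- by move=> k /set_mem Pk; apply: mh; exists k.
Qed.

(** Taking roots moves the power to the other side: the partial sums are at most [(L/c)^(1/p)], a
    bound that passes to the limit. *)
Lemma poweR_nneseries_le (u : nat -> \bar R) (P : pred nat) (p c : R) (L : \bar R) :
  (0 < p)%R -> (0 < c)%R -> (forall i, P i -> 0 <= u i) ->
  (forall n, (\sum_(0 <= i < n | P i) u i) `^ p * c%:E <= L) ->
  (\sum_(0 <= i <oo | P i) u i) `^ p * c%:E <= L.
Proof.
move=> p0 c0 u0 uL.
have L0 : 0 <= L.
  by apply: le_trans (uL 0%N); rewrite mule_ge0 ?poweR_ge0// lee_fin ltW.
have [->|Loo] := eqVneq L +oo; first by rewrite leey.
have Lfin : L \is a fin_num by rewrite ge0_fin_numE// ltey.
have s0 n : 0 <= \sum_(0 <= i < n | P i) u i by exact: sume_ge0.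
rewrite -lee_pdivlMr//.
have D0 : 0 <= L * (c^-1)%:E by rewrite mule_ge0// lee_fin invr_ge0 ltW.
have -> : L * (c^-1)%:E = ((L * (c^-1)%:E) `^ p^-1) `^ p.
  by rewrite -poweRrM mulVf ?gt_eqF// poweRe1.
apply: gt0_ler_poweR; first exact: ltW.
- by rewrite in_itv/= leey andbT nneseries_ge0// => i _; exact: u0.
- by rewrite in_itv/= leey andbT poweR_ge0.
apply: lime_le; first by apply: is_cvg_nneseries => i _; exact: u0.
apply: nearW => n.
have -> : \sum_(0 <= i < n | P i) u i = ((\sum_(0 <= i < n | P i) u i) `^ p) `^ p^-1.
  by rewrite -poweRrM mulfV ?gt_eqF// poweRe1.
apply: gt0_ler_poweR; first by rewrite invr_ge0 ltW.
- by rewrite in_itv/= leey andbT poweR_ge0.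
- by rewrite in_itv/= leey andbT.
by rewrite lee_pdivlMr.
Qed.

End countable_sums.

Section sparse_sums.
Context d (T : measurableType d) (R : realType) (mu : {measure set T -> \bar R}).
Local Open Scope ereal_scope.

(** Monotone convergence along initial segments of an enumeration. The power is taken in the
    extended reals since the series is not yet known to be finite. *)
Lemma countable_sum_bound (S : set (set T)) (c : set T -> R) (v : T -> R) (p : R)
    (B : \bar R) :
  countable S -> (forall Q, S Q -> measurable Q) ->
  (forall Q, S Q -> 0 <= c Q)%R -> measurable_fun setT v ->
  (forall x, 0 < v x)%R -> (0 < p)%R ->
  (forall r : seq (set T), uniq r -> (forall Q, Q \in r -> S Q) ->
    \int[mu]_x ((\sum_(Q <- r) c Q * \1_Q x) `^ p * v x)%:E <= B) ->
  \int[mu]_x ((\esum_(Q in S) (c Q * \1_Q x)%:E) `^ p * (v x)%:E) <= B.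
Proof.
move=> /countable_enumeration[e [P [einj SE]]] mS c0 mv v0 p0 hB.
have SP n : P n -> S (e n) by move=> Pn; rewrite SE; exists n.
pose r n := [seq e i | i <- index_iota 0 n & i \in P].
have rS n Q : Q \in r n -> S Q.
  by move=> /mapP[i]; rewrite mem_filter => /andP[/set_mem Pi _] ->; exact: SP.
have ur n : uniq (r n).
  rewrite map_inj_in_uniq ?filter_uniq ?iota_uniq// => i j.
  by rewrite !mem_filter => /andP[iP _] /andP[jP _]; exact: einj.
pose h n x := ((\sum_(Q <- r n) c Q * \1_Q x) `^ p * v x)%R.
have rE n x : (\sum_(Q <- r n) c Q * \1_Q x)%:E =
    \sum_(0 <= i < n | i \in P) (c (e i) * \1_(e i) x)%:E.
  by rewrite /r big_map big_filter -sumEFin.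
have term0 x i : i \in P -> 0 <= (c (e i) * \1_(e i) x)%:E.
  by move=> /set_mem Pi; rewrite lee_fin mulr_ge0 ?c0//; exact: SP.
have r0 n x : (0 <= \sum_(Q <- r n) c Q * \1_Q x)%R.
  by rewrite -lee_fin rE sume_ge0// => i; exact: term0.
have h0 n x : (0 <= h n x)%R by rewrite mulr_ge0 ?powR_ge0// ltW.
have mh n : measurable_fun setT (h n).
  apply: measurable_funM => //; apply: (measurableT_comp (measurable_powR p)).
  rewrite (_ : (fun x => _) = (fun x => \sum_(i <- index_iota 0 n)
      if i \in P then c (e i) * \1_(e i) x else 0)%R); last first.
    by apply/funext => x; rewrite /r big_map big_filter big_mkcond.
  apply: measurable_sum => i; case: (boolP (i \in P)) => // /set_mem Pi.
  by apply: measurable_funM => //; apply/measurable_indic/mS/SP.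
have nd x : {homo (fun n => (h n x)%:E) : n m / (n <= m)%N >-> n <= m}.
  move=> n m nm; rewrite lee_fin ler_pM2r// ge0_ler_powR ?nnegrE ?(ltW p0)//.
  by rewrite -lee_fin !rE; apply: lee_sum_nneg_natr => // i _; exact: term0.
have cvh x : cvgn (fun n => (h n x)%:E) by exact: ereal_nondecreasing_is_cvgn.
apply: (@le_trans _ _ (\int[mu]_x limn (fun n => (h n x)%:E))).
  apply: ge0_le_integral => //.
  - by move=> x _; rewrite mule_ge0 ?poweR_ge0// lee_fin ltW.
  - apply: emeasurable_funM; last exact/measurable_EFinP.
    apply: (measurableT_comp (measurable_poweR p)).
    apply: measurable_countable_esum => [|Q SQ|Q x SQ].
    + by rewrite SE; apply: card_le_trans (card_image_le _ _) _; exact: countableP.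
    + apply/measurable_EFinP/measurable_funM => //; exact/measurable_indic/mS.
    + by rewrite lee_fin mulr_ge0// c0.
  - apply: (emeasurable_fun_cvg (fun n x => (h n x)%:E)) => [n|x _].
      exact/measurable_EFinP.
    exact: cvh.
  move=> x _; rewrite SE esum_set_image//; last first.
    by move=> n Pn; apply: (term0 x); exact: mem_set.
  apply: poweR_nneseries_le => // [i|n]; first exact: term0.
  rewrite -rE poweR_EFin -EFinM -/(h n x).
  apply: lime_ge; first exact: cvh.
  by exists n => // k /= nk; exact: nd.
rewrite monotone_convergence//; last first.
- by move=> n x _; rewrite lee_fin.
- by move=> n; exact/measurable_EFinP.
apply: lime_le.
  apply: ereal_nondecreasing_is_cvgn => n m nm; apply: ge0_le_integral => //.
  - by move=> x _; rewrite lee_fin.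
  - exact/measurable_EFinP.
  - exact/measurable_EFinP.
  - by move=> x _; exact: nd.
by apply: nearW => n; apply: hB; [exact: ur|exact: rS].
Qed.

End sparse_sums.

(** * The sparse operator *)

Section pos_fine.
Variable R : realType.
Local Open Scope ereal_scope.

(** The value 1 is used only on the null set where a weight is 0 or infinite, so that the weight
    becomes real and positive everywhere. *)
Definition pos_fine (y : \bar R) : R := if 0 < y < +oo then fine y else 1%R.

Lemma pos_fine_gt0 y : (0 < pos_fine y)%R.
Proof. by rewrite /pos_fine; case: ifPn => // h; rewrite fine_gt0. Qed.

Lemma measurable_pos_fine : measurable_fun setT pos_fine.
Proof.
apply: (@measurable_fun_ifT _ _ _ _ (@fine R) (cst 1%R)
  (fun y : \bar R => (0 < y) && (y < +oo))) => //.
by apply: measurable_and; exact: measurable_fun_lte.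
Qed.

End pos_fine.


Section real_weight.
Context d (T : measurableType d) (R : realType) (mu : {measure set T -> \bar R}).
Local Open Scope ereal_scope.
Variable w : T -> \bar R.
Hypotheses (mw : measurable_fun setT w) (w_fin : {ae mu, forall x, 0 < w x < +oo}).

Definition real_weight (x : T) : R := pos_fine (w x).

Lemma real_weight_gt0 x : (0 < real_weight x)%R.
Proof. exact: pos_fine_gt0. Qed.

Lemma measurable_real_weight : measurable_fun setT real_weight.
Proof. exact: (measurableT_comp (@measurable_pos_fine R)). Qed.

Lemma ae_real_weight : {ae mu, forall x, w x = (real_weight x)%:E}.
Proof.
apply: filterS w_fin => x h; rewrite /real_weight /pos_fine h fineK//.
by case/andP: h => h0 hoo; rewrite ge0_fin_numE// ltW.
Qed.

(** [phi] is the identity for [w] and a power for its dual weight. *)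
Lemma integral_real_weight (A : set T) (phi : \bar R -> \bar R) :
  measurable A -> measurable_fun setT phi ->
  \int[mu]_(x in A) phi (w x) = \int[mu]_(x in A) phi (real_weight x)%:E.
Proof.
move=> mA mphi; apply: ae_eq_integral => //.
- apply: measurable_funS (subsetT _) _ => //; exact: measurableT_comp.
- apply: measurable_funS (subsetT _) _ => //; apply: measurableT_comp => //.
  by apply/measurable_EFinP; exact: measurable_real_weight.
- by apply: filterS ae_real_weight => x -> _.
Qed.

Lemma integral_mul_real_weight (g : T -> R) : measurable_fun setT g ->
  \int[mu]_x ((g x)%:E * w x) = \int[mu]_x (g x * real_weight x)%:E.
Proof.
move=> mg; apply: ae_eq_integral => //.
- by apply: emeasurable_funM => //; exact/measurable_EFinP.
- by apply/measurable_EFinP/measurable_funM => //; exact: measurable_real_weight.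
- by apply: filterS ae_real_weight => x -> _; rewrite EFinM.
Qed.

End real_weight.

(** * Cubes, dyadic grids and Lebesgue measure *)

Section lebesgue_Rn_facts.
Variables (R : realType) (n : nat).
Local Notation T := (Rn R n).
Local Notation mu := (@lebesgue_Rn R n).
Local Open Scope ereal_scope.

Lemma measurable_cube (Q : set T) : cube Q -> measurable Q.
Proof.
move=> [l [a [bl [br [l0 ->]]]]]; apply: sub_caratheodory.
apply: sub_sigma_algebra.
rewrite (_ : [set x | _] = \bigcap_(i in [set: 'I_n])
    ((fun x : n.-tuple (measurableTypeR R) => tnth x i) @^-1`
    [set` Interval (BSide (bl i) (a i)) (BSide (br i) (a i + l)%R)])); last first.
  by apply/seteqP; split => [x xQ i _|x xQ i]; [exact: xQ|exact: xQ].
apply: fin_bigcap_measurable => // i _.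
by rewrite -[X in measurable X]setTI; apply: measurable_tnth.
Qed.

(** The completed measure is the outer measure itself, hence monotone on all sets; this applies
    directly to the union in [sparse]. *)
Lemma le_lebesgue_Rn (A B : set T) : A `<=` B -> mu A <= mu B.
Proof. by move=> AB; apply: (le_outer_measure (borel_lebesgue R n)^*%mu). Qed.

Lemma sigma_finite_lebesgue_Rn : sigma_finite setT mu.
Proof. exact/completed_measure_extension_sigma_finite/sigma_finiteT. Qed.

Section dyadic_grids.
Variable D : set (set T).
Hypothesis HD : dyadic_grid D.

Lemma dyadic_measurable Q : D Q -> measurable Q.
Proof. by case: HD => Dc _ _ _ /Dc; exact: measurable_cube. Qed.

Lemma dyadic_measure_fin Q : D Q -> 0 < mu Q < +oo.
Proof.
case: HD => _ Dmu _ _ /Dmu[k ->].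
by rewrite lte_fin ltry andbT exprz_gt0.
Qed.

Lemma dyadic_nested P Q : D P -> D Q ->
  P `&` Q !=set0 -> P `<=` Q \/ Q `<=` P.
Proof.
case: HD => _ _ Dn _ DP DQ; have [->|E|E] := Dn _ _ DP DQ.
- by move=> [].
- by right; apply/setIidPr.
- by left; apply/setIidPl.
Qed.

(** There are countably many generations, each a disjoint family of sets of positive measure in a
    sigma-finite space. *)
Lemma countable_dyadic_grid : countable D.
Proof.
pose Dk (k : int) := [set Q | D Q /\ mu Q = ((2 : R) ^ (n%:Z * k))%:E].
have DE : D `<=` \bigcup_(k in setT) Dk k.
  by move=> Q DQ; case: HD => _ /(_ _ DQ)[k Qk] _ _; exists k.
apply: (sub_countable (subset_card_le DE)).
apply: bigcup_countable => // k _.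
apply: (countable_trivIset_measure sigma_finite_lebesgue_Rn).
  by case: HD => _ _ _ /(_ k)[].
move=> Q [DQ _]; split; first exact: dyadic_measurable.
by have /andP[] := dyadic_measure_fin DQ.
Qed.

(** One cube is enough to see that the supremum [Ap_const] is nonnegative. *)
Lemma dyadic_nonempty : exists Q, D Q.
Proof.
case: HD => _ _ _ /(_ 0%R)[E _ _].
have : [set: T] (point : T) by [].
by rewrite -E => -[Q [DQ _] _]; exists Q.
Qed.

End dyadic_grids.

End lebesgue_Rn_facts.

(** * Convergence and boundedness of the sparse operator *)

Section sparse_operator.
Context d (T : measurableType d) (R : realType) (mu : {measure set T -> \bar R}).
Variables (v : T -> R) (p q K : R) (S : set (set T)).
Hypotheses (mv : measurable_fun setT v) (v0 : forall x, (0 < v x)%R).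
Hypotheses (p0 : (0 < p)%R) (q0 : (0 < q)%R) (pq : (p^-1 + q^-1 = 1)%R).
Hypothesis K0 : (0 <= K)%R.
Local Open Scope ereal_scope.
Hypotheses (S_count : countable S) (mS : forall Q, S Q -> measurable Q)
  (S_fin : forall Q, S Q -> 0 < mu Q < +oo)
  (S_nest : forall P Q, S P -> S Q -> P `&` Q !=set0 -> P `<=` Q \/ Q `<=` P)
  (S_sparse : forall (r : seq (set T)) Q, S Q ->
     (forall P, P \in r -> S P /\ P `<` Q) ->
     mu (\big[setU/set0]_(P <- r) P) <= (2^-1)%:E * mu Q)
  (S_Ap : forall Q, S Q ->
     (\int[mu]_(x in Q) (v x)%:E) `^ p^-1 *
     (\int[mu]_(x in Q) (v x `^ (1 - q))%:E) `^ q^-1 <= (K `^ p^-1)%:E * mu Q).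
Variable f : T -> R.
Hypothesis mf : measurable_fun setT f.
Hypothesis f_fin : \int[mu]_x (`|f x| `^ p * v x)%:E < +oo.

Let C := (p * q * 2 `^ Num.max (p / q) (q / p) * K `^ Num.max 1 (q / p))%R.

Let mnf : measurable_fun setT (fun x => `|f x|%R).
Proof. exact: measurableT_comp. Qed.

Let nf0 x : (0 <= `|f x|)%R.
Proof. exact: normr_ge0. Qed.

Let term (x : T) (Q : set T) : \bar R :=
  ((mu Q)^-1 * \int[mu]_(y in Q) (f y)%:E) * (\1_Q x)%:E.

Let c Q := (fine (\int[mu]_(x in Q) `|f x|%:E) / fine (mu Q))%R.

(** The sparse operator applied to [|f|], in the extended reals; it dominates the series of absolute
    values at every point. *)
Let G x := \esum_(Q in S) (c Q * \1_Q x)%:E.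

Let abs_fin Q : S Q -> \int[mu]_(x in Q) `|f x|%:E < +oo.
Proof.
exact: (sparse_integral_fin mv v0 p0 q0 pq mS S_fin S_Ap mnf nf0 f_fin).
Qed.

Lemma sparse_integrable Q : S Q -> mu.-integrable Q (EFin \o f).
Proof.
move=> SQ; apply/integrableP; split; last exact: abs_fin.
by apply/measurable_EFinP; exact: measurable_funS mf.
Qed.

Let mu_gt0 Q : S Q -> (0 < fine (mu Q))%R.
Proof. by move=> /S_fin h; rewrite fine_gt0. Qed.

Let mu_fineK Q : S Q -> (fine (mu Q))%:E = mu Q.
Proof. by move=> /S_fin/andP[h hoo]; rewrite fineK// ge0_fin_numE// ltW. Qed.

Let c0 Q : S Q -> (0 <= c Q)%R.
Proof.
move=> SQ; rewrite divr_ge0 ?(ltW (mu_gt0 SQ))//.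
by rewrite fine_ge0// integral_ge0// => x _; rewrite lee_fin.
Qed.

Let termE x Q : S Q -> term x Q =
  (fine (\int[mu]_(y in Q) (f y)%:E) / fine (mu Q) * \1_Q x)%:E.
Proof.
move=> SQ; rewrite /term -(mu_fineK SQ) inver gt_eqF ?mu_gt0//.
have /fineK <- : \int[mu]_(y in Q) (f y)%:E \is a fin_num.
  exact: (integrable_fin_num (mS SQ) (sparse_integrable SQ)).
by rewrite -!EFinM [X in (X * _)%:E]mulrC.
Qed.

Let term_le x Q : S Q -> `|term x Q| <= (c Q * \1_Q x)%:E.
Proof.
move=> SQ; rewrite termE//= lee_fin normrM [X in (_ * X <= _)%R]ger0_norm//.
rewrite ler_wpM2r// normrM [X in (_ * X <= _)%R]ger0_norm; last first.
  by rewrite invr_ge0 ltW// mu_gt0.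
rewrite ler_wpM2r ?invr_ge0 ?(ltW (mu_gt0 SQ))//.
have ffin := integrable_fin_num (mS SQ) (sparse_integrable SQ).
rewrite -lee_fin -abse_EFin fineK//.
rewrite [leRHS]fineK; last first.
  rewrite ge0_fin_numE ?abs_fin// integral_ge0// => y _; by rewrite lee_fin.
apply: le_abse_integral; first exact: mS.
by apply/measurable_EFinP; exact: measurable_funS mf.
Qed.

Let mterm Q : S Q -> measurable_fun setT (term^~ Q).
Proof.
move=> SQ; under eq_fun do rewrite termE//.
by apply/measurable_EFinP/measurable_funM => //; exact/measurable_indic/mS.
Qed.

Let G_ge0 x : 0 <= G x.
Proof. by apply: esum_ge0 => Q SQ; rewrite lee_fin mulr_ge0 ?c0. Qed.

Let mG : measurable_fun setT G.
Proof.
apply: measurable_countable_esum => // [Q SQ|Q x SQ].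
  by apply/measurable_EFinP/measurable_funM => //; exact/measurable_indic/mS.
by rewrite lee_fin mulr_ge0 ?c0.
Qed.

Let C_ge0 : (0 <= C)%R.
Proof. by rewrite !mulr_ge0 ?powR_ge0 ?ltW. Qed.

Let f_int_ge0 : 0 <= \int[mu]_x (`|f x| `^ p * v x)%:E.
Proof. by apply: integral_ge0 => x _; rewrite lee_fin mulr_ge0 ?powR_ge0 ?ltW. Qed.

Let G_bound : \int[mu]_x (G x `^ p * (v x)%:E) <=
  (C%:E * (\int[mu]_x (`|f x| `^ p * v x)%:E) `^ p^-1) `^ p.
Proof.
(* The finite bound is uniform in the list, so its [p]-th power can serve as [B]. *)
apply: countable_sum_bound => // r ur rS.
have := sparse_finite_bound mv v0 p0 q0 pq K0 mS S_fin S_nest S_sparse S_Ap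
  mnf nf0 f_fin ur rS.
set X := \int[mu]_x _; set Y := _ * _ => XY.
have X0 : 0 <= X.
  by apply: integral_ge0 => x _; rewrite lee_fin mulr_ge0 ?powR_ge0 ?ltW.
rewrite -[X](_ : (X `^ p^-1) `^ p = X); last first.
  by rewrite -poweRrM mulVf ?gt_eqF// poweRe1.
apply: gt0_ler_poweR => //; first exact: ltW.
- by rewrite in_itv/= leey andbT poweR_ge0.
- by rewrite in_itv/= leey andbT mule_ge0 ?poweR_ge0.
Qed.

Let abs_le_G x : \esum_(Q in S) `|term x Q| <= G x.
Proof. by apply: le_esum => Q SQ; exact: term_le. Qed.

(** [G^p v] is integrable, hence finite almost everywhere, and [v > 0] passes finiteness on to
    [G]. *)
Lemma sparse_summable : {ae mu, forall x, summable S (term x)}.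
Proof.
have int_fin : \int[mu]_x (G x `^ p * (v x)%:E) < +oo.
  apply: (le_lt_trans G_bound); rewrite poweR_lty// lte_mul_pinfty ?lee_fin//.
  by rewrite poweR_lty.
have H : mu.-integrable setT (fun x => G x `^ p * (v x)%:E).
  apply/integrableP; split.
    apply: emeasurable_funM; last exact/measurable_EFinP.
    exact: (measurableT_comp (measurable_poweR p)).
  under eq_integral => x _.
    rewrite gee0_abs; last by rewrite mule_ge0 ?poweR_ge0// lee_fin ltW.
    over.
  exact: int_fin.
apply: filterS (integrable_ae measurableT H) => x /(_ I) xfin.
rewrite /summable (le_lt_trans (abs_le_G x))// ltey; apply/eqP => Gy.
by move: xfin; rewrite Gy poweRyr ?gt_eqF// gt0_mulye ?lte_fin ?v0.
Qed.

Let op (x : T) : R :=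
  fine (\esum_(Q in S) (term x)^\+ Q - \esum_(Q in S) (term x)^\- Q).

Lemma measurable_sparse_op : measurable_fun setT op.
Proof.
apply: (measurableT_comp (fine_measurable measurableT)).
apply: emeasurable_funB; apply: measurable_countable_esum => //.
- move=> Q SQ; rewrite (_ : (fun x => _) = (term^~ Q)^\+).
    exact/measurable_funepos/mterm.
  by apply/funext => x; rewrite !funeposE.
- move=> Q SQ; rewrite (_ : (fun x => _) = (term^~ Q)^\-).
    exact/measurable_funeneg/mterm.
  by apply/funext => x; rewrite !funenegE.
Qed.

Let op_le_G x : `|op x|%:E <= G x.
Proof.
apply: le_trans (abs_le_G x).
have -> : \esum_(Q in S) `|term x Q| =
    \esum_(Q in S) (term x)^\+ Q + \esum_(Q in S) (term x)^\- Q.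
  rewrite -esumD//; apply: eq_esum => Q SQ.
  by rewrite -[LHS]/((abse \o term x) Q) fune_abse.
rewrite /op; set a := \esum_(Q in S) _; set b := \esum_(Q in S) _.
have a0 : 0 <= a by exact: esum_ge0.
have b0 : 0 <= b by exact: esum_ge0.
(* If one of the series diverges, the difference is infinite and [fine] returns 0, so the bound
   holds at every point. *)
case: a b a0 b0 => [a| |] [b| |]//= a0 b0; rewrite ?normr0 ?leey//.
by rewrite -EFinD lee_fin (le_trans (ler_normB _ _))// !ger0_norm.
Qed.

Lemma sparse_op_bound :
  (\int[mu]_x (`|op x| `^ p * v x)%:E) `^ p^-1 <=
  C%:E * (\int[mu]_x (`|f x| `^ p * v x)%:E) `^ p^-1.
Proof.
set Y := C%:E * _.
have Y0 : 0 <= Y by rewrite mule_ge0 ?poweR_ge0// lee_fin C_ge0.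
rewrite -[Y](_ : (Y `^ p) `^ p^-1 = Y); last first.
  by rewrite -poweRrM mulfV ?gt_eqF// poweRe1.
apply: gt0_ler_poweR; first by rewrite invr_ge0 ltW.
- rewrite in_itv/= leey andbT integral_ge0// => x _.
  by rewrite lee_fin mulr_ge0 ?powR_ge0 ?ltW.
- by rewrite in_itv/= leey andbT poweR_ge0.
apply: le_trans G_bound; apply: ge0_le_integral => //.
- by move=> x _; rewrite lee_fin mulr_ge0 ?powR_ge0 ?ltW.
- apply/measurable_EFinP/measurable_funM => //.
  apply: (measurableT_comp (measurable_powR p)).
  apply: measurableT_comp => //; exact: measurable_sparse_op.
- apply: emeasurable_funM; last exact/measurable_EFinP.
  exact: (measurableT_comp (measurable_poweR p)).
- move=> x _; rewrite EFinM lee_wpmul2r ?lee_fin ?(ltW (v0 x))//.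
  rewrite -poweR_EFin; apply: gt0_ler_poweR => //; first exact: ltW.
  + by rewrite in_itv/= leey andbT lee_fin.
  + by rewrite in_itv/= leey andbT.
Qed.

End sparse_operator.

(** * From the A_p constant to the operator norm *)

Section Ap_average.
Variables (R : realType) (p q : R).
Hypotheses (p0 : (0 < p)%R) (q0 : (0 < q)%R) (pq : (p^-1 + q^-1 = 1)%R).
Local Open Scope ereal_scope.

(** Take [p]-th roots: [(p - 1)/p = 1/q], and the normalising factors combine to
    [m^(-1/p) m^(-1/q) = 1/m]. *)
Lemma Ap_average_bound (m K : R) (X Y : \bar R) : (0 < m)%R -> (0 <= K)%R ->
  0 <= X -> 0 <= Y ->
  (m%:E^-1 * X) * (m%:E^-1 * Y) `^ (p - 1) <= K%:E ->
  X `^ p^-1 * Y `^ q^-1 <= (K `^ p^-1)%:E * m%:E.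
Proof.
move=> m0 K0 X0 Y0; rewrite inver gt_eqF// => h.
have im0 : 0 <= (m^-1)%:E by rewrite lee_fin invr_ge0 ltW.
have h1 : ((m^-1)%:E * X * ((m^-1)%:E * Y) `^ (p - 1)) `^ p^-1 <= K%:E `^ p^-1.
  apply: gt0_ler_poweR => //; first by rewrite invr_ge0 ltW.
  - by rewrite in_itv/= leey andbT !mule_ge0 ?poweR_ge0.
  - by rewrite in_itv/= leey andbT lee_fin.
rewrite poweRM ?mule_ge0 ?poweR_ge0// -poweRrM in h1.
have e1 : ((p - 1) * p^-1 = q^-1)%R.
  by rewrite mulrBl mulfV ?gt_eqF// mul1r -pq addrC addKr.
rewrite e1 !poweRM// muleACA !poweR_EFin -EFinM -powRD in h1; last first.
  by apply/implyP => _; rewrite invr_neq0// lt0r_neq0.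
rewrite pq powRr1 ?invr_ge0 ?(ltW m0)// in h1.
rewrite -lee_pdivrMr// muleC; exact: h1.
Qed.

End Ap_average.

Lemma conj_exp_gt0 (R : realType) (p : R) : 1 < p -> 0 < conj_exp p.
Proof. by move=> p1; rewrite divr_gt0 ?subr_gt0// (lt_trans _ p1). Qed.

Lemma conj_expV (R : realType) (p : R) : 1 < p -> p^-1 + (conj_exp p)^-1 = 1.
Proof.
move=> p1; have p0 : p != 0 by rewrite gt_eqF// (lt_trans _ p1).
by rewrite invf_div mulrBl mulfV// mul1r subrKC.
Qed.

Unset Implicit Arguments.
Set Strict Implicit.
Set Printing Implicit Defensive.

Theorem theorem3p1 (R : realType) (n : nat) (D S : set (set (Rn R n)))
    (p : R) (w : Rn R n -> \bar R) :
  dyadic_grid D -> S `<=` D -> sparse S -> 1 < p -> Ap p w ->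
  let p' := conj_exp p in
  let c := p * p' * 2 `^ Num.max (p / p') (p' / p) in
  sparse_op_well_defined S p w /\
  (Lpw_opnorm p w (sparse_op S) <=
     c%:E * Ap_const p w `^ (Num.max 1 (p' / p))%R)%E.
Proof.
move=> HD SD Ssp p1 [[mw w_fin] Kfin] p' c.
pose mu : {measure set (Rn R n) -> \bar R} := @lebesgue_Rn R n.
have p0 : 0 < p by rewrite (lt_trans _ p1).
have q0 : 0 < p' by exact: conj_exp_gt0.
have pq : p^-1 + p'^-1 = 1 by exact: conj_expV.
pose v := real_weight w.
have mv : measurable_fun setT v by exact: measurable_real_weight.
have v0 x : 0 < v x by exact: real_weight_gt0.
have Lpw_normE (h : Rn R n -> R) : measurable_fun setT h ->
    Lpw_norm p w h = ((\int[mu]_x (`|h x| `^ p * v x)%:E) `^ p^-1)%E.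
  move=> mh.
  have mhp : measurable_fun setT (fun x => `|h x| `^ p).
    apply: (measurableT_comp (measurable_powR p)); exact: measurableT_comp mh.
  by rewrite -(integral_mul_real_weight mw w_fin mhp).
have average_ge0 h Q : (forall x, 0 <= h x)%E -> D Q ->
    (0 <= (mu Q)^-1 * \int[mu]_(x in Q) h x)%E.
  move=> h0 DQ; have /andP[Q0 _] := dyadic_measure_fin HD DQ.
  by rewrite mule_ge0 ?inve_ge0 ?integral_ge0// ltW.
have D_Ap Q : D Q -> ((mu Q)^-1 * \int[mu]_(x in Q) (v x)%:E *
    ((mu Q)^-1 * \int[mu]_(x in Q) (v x `^ (1 - p'))%:E) `^ (p - 1) <=
    Ap_const p w)%E.
  move=> DQ; have mQ := dyadic_measurable HD DQ.
  rewrite -(integral_real_weight mw w_fin mQ (@measurable_id _ _ setT)).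
  have -> : (\int[mu]_(x in Q) (v x `^ (1 - p'))%:E =
      \int[mu]_(x in Q) (w x `^ (1 - p')))%E.
    by rewrite (integral_real_weight mw w_fin mQ (measurable_poweR (1 - p'))).
  apply: ereal_sup_ubound; exists Q => //.
  by case: HD => /(_ _ DQ).
(* Finite by hypothesis, and nonnegative because it dominates the A_p product of some cube of the
   grid. *)
have [K K0 KE] : exists2 K, 0 <= K & Ap_const p w = K%:E.
  have [Q DQ] := dyadic_nonempty HD.
  have A0 : (0 <= Ap_const p w)%E.
    apply: le_trans (D_Ap _ DQ); rewrite mule_ge0 ?poweR_ge0//.
    by apply: average_ge0 => // x; rewrite lee_fin ltW.
  exists (fine (Ap_const p w)); first exact: fine_ge0.
  by rewrite fineK// ge0_fin_numE.
have S_count : countable S.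
  exact: sub_countable (subset_card_le SD) (countable_dyadic_grid HD).
have mS Q : S Q -> measurable Q by move=> /SD; exact: dyadic_measurable.
have S_fin Q : S Q -> (0 < mu Q < +oo)%E by move=> /SD; exact: dyadic_measure_fin.
have S_nest P Q : S P -> S Q -> P `&` Q !=set0 -> P `<=` Q \/ Q `<=` P.
  by move=> /SD DP /SD DQ; exact: (dyadic_nested HD).
have S_sparse (r : seq (set (Rn R n))) Q : S Q ->
    (forall P, P \in r -> S P /\ P `<` Q) ->
    (mu (\big[setU/set0]_(P <- r) P) <= (2^-1)%:E * mu Q)%E.
  move=> SQ rQ; apply: le_trans (Ssp _ SQ); apply: le_lebesgue_Rn.
  rewrite -bigcup_seq => x [P /= Pr Px]; exists P => //; exact: rQ.
have S_Ap Q : S Q -> ((\int[mu]_(x in Q) (v x)%:E) `^ p^-1 *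
    (\int[mu]_(x in Q) (v x `^ (1 - p'))%:E) `^ p'^-1 <= (K `^ p^-1)%:E * mu Q)%E.
  move=> SQ; have := D_Ap _ (SD _ SQ); rewrite KE.
  have /andP[Q0 Qoo] := S_fin _ SQ.
  have Qfin : mu Q \is a fin_num by rewrite ge0_fin_numE.
  rewrite -(fineK Qfin).
  apply: Ap_average_bound => //.
  - by rewrite fine_gt0 ?Q0.
  - by apply: integral_ge0 => x _; rewrite lee_fin ltW.
  - by apply: integral_ge0 => x _; rewrite lee_fin powR_ge0.
have f_fin f : Lpw p w f -> (\int[mu]_x (`|f x| `^ p * v x)%:E < +oo)%E.
  move=> [mf]; rewrite Lpw_normE//; apply: lty_poweRy.
  by rewrite gt_eqF// invr_gt0.
have m_op f : Lpw p w f -> measurable_fun setT (sparse_op S f).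
  move=> Lf; have [mf _] := Lf.
  exact: (measurable_sparse_op mv v0 p0 q0 pq S_count mS S_fin S_Ap mf (f_fin _ Lf)).
have bound f : Lpw p w f -> (Lpw_norm p w (sparse_op S f) <=
    (c * K `^ Num.max 1 (p' / p))%:E * Lpw_norm p w f)%E.
  move=> Lf; have [mf _] := Lf; rewrite (Lpw_normE _ mf) (Lpw_normE _ (m_op _ Lf)).
  exact: (sparse_op_bound mv v0 p0 q0 pq K0 S_count mS S_fin S_nest S_sparse
    S_Ap mf (f_fin _ Lf)).
have cK0 : 0 <= c * K `^ Num.max 1 (p' / p).
  apply: mulr_ge0; last exact: powR_ge0.
  by apply: mulr_ge0; [exact/ltW/mulr_gt0|exact: powR_ge0].
split=> [f Lf|].
  have [mf Nf] := Lf; split.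
  - by move=> Q; apply: (sparse_integrable mv v0 p0 q0 pq mS S_fin S_Ap mf (f_fin _ Lf)).
  - exact: (sparse_summable mv v0 p0 q0 pq K0 S_count mS S_fin S_nest S_sparse
      S_Ap mf (f_fin _ Lf)).
  - split; first exact: m_op.
    by rewrite (le_lt_trans (bound _ Lf))// lte_mul_pinfty.
rewrite KE poweR_EFin -EFinM; apply: ge_ereal_sup => _ [f [Lf /= f1] <-].
apply: (le_trans (bound _ Lf)).
by rewrite -[leRHS]mule1 lee_wpmul2l// lee_fin.
Qed.
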